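(* Consider the regression model $Y=f_0(X)+\epsilon$ with i.i.d. sample $(Y_i,X_i)_{i=1}^n$, and the fully connected deep neural networks $f_\theta$, $\theta\in\Theta_{L,D}$, with activation function $\phi$, depth $L$ and width $D$, as described in the context. Assume: (i) $\phi:\mathbb{R}\to\mathbb{R}$ is $1$-Lipschitz and satisfies $|\phi(x)|\le |x|$ for all $x\in\mathbb{R}$; for constants $C\ge 1$ and $B\ge 1$, $\|f_0\|_\infty\le C$, $\|f_\theta\|_\infty\le C$ for all $\theta\in\Theta_{L,D}$, and all coefficients of $\theta\in\Theta_{L,D}$ are bounded by $B$ in absolute value; (ii) there exist constants $\sigma,\varsigma>0$ such that $\mathbb{E}(|\epsilon|^k\mid X)\le \frac{k!}{2}\sigma^2\varsigma^{k-2}$ for all integers $k\ge 2$. Put $C^*_{\sigma,\varsigma}:=16\,[C^2+\sigma^2+C(\varsigma\vee(2C))]$ and $\lambda=n/C^*_{\sigma,\varsigma}$. Let $\beta>0$ and take $L\asymp \log(n)$, $D\asymp n^{\frac{d}{2(2\beta+d)}}$. Let $\psi_n:=n^{-\frac{2\beta}{2\beta+d}}(\log n)^3$. Then there is a constant $\mathcal{C}>0$ depending only on $B,C,\sigma,\varsigma$ such that $$\mathbb{E}\,\mathbb{E}_{\theta\sim\hat\rho_\lambda}[R(\theta)]-R(f_0)\le \min_{\theta\in\Theta_{L,D}}\frac{8}{3}\,[R(\theta)-R(f_0)]+\mathcal{C}\,\psi_n,$$ and, for any $\delta\in(0,1)$, $$\mathbb{P}\Big\{\mathbb{E}_{\theta\sim\hat\rho_\lambda}[R(\theta)]-R(f_0)\le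 \min_{\theta\in\Theta_{L,D}}4\,[R(\theta)-R(f_0)]+\mathcal{C}\,\psi_n+\mathcal{C}\,\frac{\log(2/\delta)}{n}\Big\}\ge 1-\delta.$$
   Context: Regression model: $(Y_i,X_i)\in\mathbb{R}\times[0,1]^d$, $i=1,\dots,n$ ($n\ge 2$), are i.i.d. copies of $(Y,X)$ with $Y=f_0(X)+\epsilon$, where $X$ is uniformly distributed on $[0,1]^d$, $f_0:[0,1]^d\to\mathbb{R}$ is unknown, and $\mathbb{E}(\epsilon\mid X)=0$. Networks: $f_\theta:\mathbb{R}^d\to\mathbb{R}$ is defined by $x^{(0)}=x$, $x^{(\ell)}=\phi(W_\ell x^{(\ell-1)}+b_\ell)$ for $\ell=1,\dots,L-1$, and $f_\theta(x)=\phi(W_Lx^{(L-1)}+b_L)$, with $\phi$ applied componentwise, $W_\ell\in\mathbb{R}^{D_\ell\times D_{\ell-1}}$, $b_\ell\in\mathbb{R}^{D_\ell}$, $D_0=d$, $D_L=1$, $D_\ell=D$ for $1\le\ell\le L-1$; the depth satisfies $L\ge 3$ and the width $D\ge d$. The parameter is $\theta=\{(W_\ell,b_\ell)\}_{\ell=1}^L$, also viewed as a vector of coefficients. $\Theta_{L,D}$ is the set of all such parameters, whose coefficients are all bounded in absolute value by $B$. For a function $f$ on $[0,1]^d$, $\|f\|_\infty=\sup_{t\in[0,1]^d}|f(t)|$. Risks: $R(\theta)=R(f_\theta)=\mathbb{E}[(Y-f_\theta(X))^2]$, $R(f_0)=\mathbb{E}[(Y-f_0(X))^2]$, and $r_n(\theta)=\frac1n\sum_{i=1}^n(Y_i-f_\theta(X_i))^2$.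 Prior and Gibbs posterior: the prior $\pi$ makes the coefficients of $\theta$ independent $\mathcal{N}(0,1)$. For $\lambda>0$, $\hat\rho_\lambda$ is the probability measure on $\Theta_{L,D}$ with density proportional to $\exp[-\lambda r_n(\theta)]\,\pi(\theta)$. $\mathbb{E}_{\theta\sim\hat\rho_\lambda}$ is the expectation over $\theta$ given the sample; $\mathbb{E}$ and $\mathbb{P}$ refer to the sample. $a\vee b=\max(a,b)$. $a_n\asymp b_n$ means $c\,b_n\le a_n\le c'\,b_n$ for fixed constants $c,c'>0$. The quantities $d$, $\beta$ and the constants implicit in $\asymp$ are regarded as fixed. *)

(* Defs.v *)
From HB Require Import structures.
From mathcomp Require Import all_boot all_order all_algebra.
From mathcomp Require Import all_classical all_reals all_analysis.
Set Implicit Arguments.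
Unset Strict Implicit.
Unset Printing Implicit Defensive.
Import Order.TTheory GRing.Theory Num.Def Num.Theory.
Import numFieldNormedType.Exports.
Local Open Scope classical_set_scope.
Local Open Scope ring_scope.

Section power_probability.
Context d (T : measurableType d) (R : realType) (P : probability T R).

Definition cons_pair n (x : T * n.-tuple T) : n.+1.-tuple T :=
  [the n.+1.-tuple T of x.1 :: x.2].

Lemma measurable_cons_pair n : measurable_fun setT (@cons_pair n).
Proof. exact: measurable_cons. Qed.

HB.instance Definition _ n :=
  @isMeasurableFun.Build _ _ _ _ (@cons_pair n) (@measurable_cons_pair n).

(* The law of [n] independent draws from [P]. *)
Fixpoint power_prob n : probability (n.-tuple T) R :=
  if n is n'.+1
  then distribution (P \x power_prob n')%E (@cons_pair n')
  else \d_([tuple]).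

End power_probability.

Section real_laws.
Context {R : realType}.

(* The library's real laws live on [measurableTypeR R], which has the same
   measurable sets as [R] but another display. *)
Definition idTR : measurableTypeR R -> R := idfun.

HB.instance Definition _ :=
  @isMeasurableFun.Build _ _ _ _ idTR (@measurable_id _ _ setT).

Definition uniform01 : probability R R :=
  distribution (uniform_prob (@ltr01 R)) idTR.

Definition std_normal : probability R R :=
  distribution (normal_prob (0 : R) 1) idTR.

End real_laws.

Section cube.
Context {R : realType} {d : nat}.

Definition cube : set (d.-tuple R) :=
  [set x | forall i, 0 <= tnth x i <= 1].

Definition sup_norm (f : d.-tuple R -> R) : \bar R :=
  ereal_sup [set `|f x|%:E | x in cube].

Definition uniform_cube : probability (d.-tuple R) R :=
  power_prob uniform01 d.

End cube.

Section networks.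
Context {R : realType} (d L D : nat).

(* One index per coefficient, layer by layer: first layer (D x d), the L - 2
   middle layers (D x D), output layer (1 x D).  In a layer, [(i, Some j)] is
   the weight in row i and column j, and [(i, None)] is the i-th bias. *)
Definition coef_index : finType :=
  (('I_D * option 'I_d) + ('I_L.-2 * ('I_D * option 'I_D))
    + ('I_1 * option 'I_D))%type.

Definition parameter : Type := #|coef_index|.-tuple R.

Definition coef (theta : parameter) (c : coef_index) : R :=
  tnth theta (enum_rank c).

Definition Theta (B : R) : set parameter :=
  [set theta | forall c, `|coef theta c| <= B].

Definition layer (phi : R -> R) m n (a : 'I_m * option 'I_n -> R)
    (x : 'cV[R]_n) : 'cV[R]_m :=
  map_mx phi (\matrix_(i, j) a (i, Some j) *m x + \col_i a (i, None)).

Definition network (phi : R -> R) (theta : parameter) (x : d.-tuple R) : R :=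
  let first := layer phi (fun p => coef theta (inl (inl p))) in
  let middle l := layer phi (fun p => coef theta (inl (inr (l, p)))) in
  let output := layer phi (fun p => coef theta (inr p)) in
  output (foldl (fun h l => middle l h) (first (\col_i tnth x i))
                (enum 'I_L.-2)) ord0 ord0.

(* Untruncated; the restriction to [Theta B] takes place in [gibbs]. *)
Definition prior : probability (#|coef_index|.-tuple R) R :=
  power_prob std_normal #|coef_index|.

End networks.

(* The law on [S] whose density with respect to [mu] is proportional to
   [expR (- lambda * r)], as a set function: it is a probability measure when
   [S] and [r] are measurable, [0 <= lambda], [0 <= r] and [0 < mu S]. *)
Definition gibbs {R : realType} {d} {T : measurableType d}
    (mu : probability T R) (S : set T) (lambda : R) (r : T -> R)
    (A : set T) : \bar R :=
  ((\int[mu]_(t in S `&` A) (expR (- lambda * r t))%:E) *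
   (fine (\int[mu]_(t in S) (expR (- lambda * r t))%:E))^-1%:E)%E.

Section probability_notions.
Context {R : realType} {d} {Omega : measurableType d}.
Variable P : probability Omega R.

(* [g \o X] is a version of E(Z | X). *)
Definition is_cond_exp d' (S : measurableType d') (Z : Omega -> R)
    (X : Omega -> S) (g : S -> R) : Prop :=
  [/\ P.-integrable setT (EFin \o Z),
      measurable_fun setT g,
      P.-integrable setT (EFin \o (g \o X)) &
      forall A, measurable A ->
        (\int[P]_(w in X @^-1` A) (g (X w))%:E =
         \int[P]_(w in X @^-1` A) (Z w)%:E)%E].

(* E(Z | X) <= c almost surely. *)
Definition cond_exp_le d' (S : measurableType d') (Z : Omega -> R)
    (X : Omega -> S) (c : R) : Prop :=
  exists2 g, is_cond_exp Z X g & {ae P, forall w, g (X w) <= c}.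

Definition mutually_independent d' (S : measurableType d') n
    (Z : 'I_n -> Omega -> S) : Prop :=
  forall (J : {set 'I_n}) (A : 'I_n -> set S),
    (forall i, measurable (A i)) ->
    P (\bigcap_(i in [set` J]) Z i @^-1` A i) =
    (\prod_(i in J) P (Z i @^-1` A i))%E.

Definition iid_copies d' (S : measurableType d') n
    (Z0 : {RV P >-> S}) (Z : 'I_n -> {RV P >-> S}) : Prop :=
  mutually_independent (fun i => Z i : Omega -> S) /\
  forall i A, measurable A -> distribution P (Z i) A = distribution P Z0 A.

End probability_notions.

Section regression.
Context {R : realType} (d : nat).
Local Notation obs := (R * d.-tuple R)%type.

Definition risk d0 (Omega : measurableType d0) (P : probability Omega R)
    (Z : Omega -> obs) (f : d.-tuple R -> R) : \bar R :=
  'E_P[fun w => ((Z w).1 - f (Z w).2) ^+ 2].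

Definition empirical_risk n (z : 'I_n -> obs) (f : d.-tuple R -> R) : R :=
  n%:R^-1 * \sum_(i < n) ((z i).1 - f (z i).2) ^+ 2.

(* Y = f0(X) + epsilon, with Z = (Y, X).  Since X lies in the cube almost
   surely, the values of [f0] elsewhere play no role. *)
Definition regression_model d0 (Omega : measurableType d0)
    (P : probability Omega R) (f0 : d.-tuple R -> R) (sigma varsigma : R)
    (Z : {RV P >-> obs}) : Prop :=
  let X w := (Z w).2 in
  let epsilon w := (Z w).1 - f0 (X w) in
  [/\ measurable_fun setT f0,
      forall A, measurable A -> P (X @^-1` A) = uniform_cube A,
      is_cond_exp P epsilon X (cst 0) &
      forall k, (2 <= k)%N ->
        cond_exp_le P (fun w => `|epsilon w| ^+ k) X
          (k`!%:R / 2 * sigma ^+ 2 * varsigma ^+ (k - 2))].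

Definition Cstar (C sigma varsigma : R) : R :=
  16 * (C ^+ 2 + sigma ^+ 2 + C * maxr varsigma (2 * C)).

Definition psi (beta : R) (n : nat) : R :=
  n%:R `^ (- (2 * beta) / (2 * beta + d%:R)) * ln n%:R ^+ 3.

End regression.

(* Main.v *)
From HB Require Import structures.
Require Import Defs.
From mathcomp Require Import all_boot all_order all_algebra.
From mathcomp Require Import all_classical all_reals all_analysis.
From mathcomp Require Import measurable_realfun ring lra.
Set Implicit Arguments.
Unset Strict Implicit.
Unset Printing Implicit Defensive.
Import Order.TTheory GRing.Theory Num.Def Num.Theory.
Import numFieldNormedType.Exports.
Local Open Scope classical_set_scope.
Local Open Scope ring_scope.

(** The proof is a PAC-Bayes argument. Write [f] for the network of parameter
    [theta] and [g = f0 - f]. Since the noise is centred given [X], the excess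
    risk of [f] is the squared distance [E g(X)^2] (lemma [risk_excess]), and the
    difference of the squared losses of [f] and [f0] at one observation is
    [g^2 + 2 eps g]. Put [t = 1 / Cstar], so that [lambda = n t]. The moment
    conditions on the noise make this loss sub-exponential at scale [t]: the
    exponential moments of [- t] and [+ t] times the loss are at most
    [exp (- 3/4 t E g^2)] and [exp (4/3 t E g^2)]
    ([integral_expRN_excess_loss_le], [integral_expR_excess_loss_le]), and
    independence raises them to the power [n] ([iid_prod_le]).

    Let [l] be [lambda] times the empirical excess risk and [e] be
    [3/4 lambda] times the excess risk. Subtracting from the empirical risk a term
    that does not depend on [theta] leaves the Gibbs posterior unchanged, so its
    density is proportional to [exp (- l)]. For a set [U] of parameters of
    positive prior mass, the posterior mean of [e] satisfies, for every sample
    and every [delta > 0],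

      mean of e <= delta A + delta V / w0 - 2 - 2 ln delta + ln w0 - ln pi(U),

    where [A] is the prior integral of [exp (e - l)], [V] is the average of
    [exp l] over [U], and [w0 >= 1] is arbitrary ([gibbs_integral_le]). This uses
    only that [exp] lies above its tangents, in place of the entropy
    inequality of Donsker and Varadhan, and the Cauchy--Schwarz
    inequality to bound the normalization of the posterior from below. By the
    two moment bounds and Fubini's theorem, [A] and [V / w0] have mean at most 1
    when [ln w0] bounds [4/3 lambda] times the excess risk on [U].
    Integrating the displayed bound with [delta = 1] gives the bound in
    expectation, and Markov's inequality for [A + V / w0] gives the bound in
    probability ([gibbs_integral_expectation_le], [gibbs_integral_deviation_le]).

    The set [U] is a small cube next to a parameter [theta0] that almost
    minimizes the risk. A network is Lipschitz in its parameter with constant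
    [L ((D + 1) B)^L] ([network_lipschitz]), so a cube of side
    [eta = 1 / (n L ((D + 1) B)^L)] keeps the predictions within [1/n] of those
    of [theta0]; its excess risk is then at most [3/2] that of [theta0] plus
    [3 / n^2] ([sq_dist_perturb]), and [(4/3) (4/3) (3/2) = 8/3]. With [p]
    coefficients the prior mass of the cube is at least [(eta phi)^p], where
    [phi] is the Gaussian density at [B] ([prior_ball]). As [p] is of order
    [L D^2] and [ln (1 / eta)] of order [(ln n)^2], the term
    [- ln pi(U) / n] is of the order of [psi] ([complexity_le_psi]). *)

(** * Integrals against densities *)

Lemma eqW {disp} {T : porderType disp} (x y : T) : x = y -> (x <= y)%O.
Proof. by move->. Qed.

Section weighted_measure.
Local Open Scope ereal_scope.
Context {R : realType} d (T : measurableType d).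
Variables (mu : {measure set T -> \bar R}) (g : T -> R).
Hypotheses (mg : measurable_fun setT g) (g0 : forall x, (0 <= g x)%R).

(** The two hypotheses are arguments so that the measure structure can be attached
    to the constant. *)
Definition weighted of measurable_fun setT g & (forall x, 0 <= g x)%R :=
  fun A : set T => \int[mu]_(x in A) (g x)%:E.

Let nu := weighted mg g0.

Let mge : measurable_fun setT (EFin \o g).
Proof. exact/measurable_EFinP. Qed.

Let weighted0 : nu set0 = 0.
Proof. exact: integral_set0. Qed.

Let weighted_ge0 A : 0 <= nu A.
Proof. by apply: integral_ge0 => x _; rewrite lee_fin. Qed.

Let weighted_sigma_additive : semi_sigma_additive nu.
Proof.
move=> F mF tF mUF; rewrite /nu /weighted ge0_integral_bigcup//.
- apply: is_cvg_ereal_nneg_natsum => n _; exact: weighted_ge0.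
- exact: measurable_funTS.
- by move=> x _; rewrite lee_fin.
Qed.

HB.instance Definition _ := isMeasure.Build _ _ _ (weighted mg g0)
  weighted0 weighted_ge0 weighted_sigma_additive.

Import HBNNSimple.

Let integral_weighted_nnsfun (f : {nnsfun T >-> R}) :
  \int[nu]_x (f x)%:E = \int[mu]_x ((f x)%:E * (g x)%:E).
Proof.
under [in LHS]eq_integral do rewrite fimfunE -fsumEFin//.
rewrite ge0_integral_fsum//; last 2 first.
- by move=> r; exact/measurable_EFinP/measurableT_comp.
- by move=> r z _; rewrite EFinM nnfun_muleindic_ge0.
under [in RHS]eq_integral => x _.
  rewrite fimfunE -fsumEFin// muleC ge0_mule_fsumr; last first.
    by move=> r; rewrite nnfun_muleindic_ge0.
  over.
rewrite ge0_integral_fsum//; last 2 first.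
- move=> r; apply: emeasurable_funM => //.
  exact/measurable_EFinP/measurableT_comp.
- move=> r z _; apply: mule_ge0; first by rewrite lee_fin.
  by rewrite nnfun_muleindic_ge0.
apply: eq_fsbigr => r _.
rewrite (integralZl_indic _ (fun r => f @^-1` [set r]))//; last first.
  by move=> r0; rewrite preimage_nnfun0.
rewrite integral_indic// setIT.
have [r0|r0] := ltP r 0%R.
  rewrite preimage_nnfun0// measure0 mule0.
  by rewrite integral0_eq// => x _; rewrite indic0 mulr0 mule0.
rewrite [X in r%:E * X](_ : _ =
  \int[mu]_(x in f @^-1` [set r]) (g x)%:E)// integral_mkcond.
rewrite -ge0_integralZl//; last 2 first.
- by apply/(measurable_restrictT _ _).1 => //; exact: measurable_funTS.
- by move=> x _; apply: erestrict_ge0 => y _; rewrite lee_fin.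
apply: eq_integral => x _; rewrite patchE indicE.
by case: ifP => _; rewrite ?mulr1 ?mulr0 ?mule0// muleC.
Qed.

(** For simple functions this is additivity; the general case is a monotone limit
    on both sides. *)
Lemma ge0_integral_weighted (f : T -> \bar R) :
  measurable_fun setT f -> (forall x, 0 <= f x) ->
  \int[weighted mg g0]_x f x = \int[mu]_x (f x * (g x)%:E).
Proof.
move=> mf f0; pose f_ := nnsfun_approx measurableT mf.
have cf x : (f_ n x)%:E @[n --> \oo] --> f x by exact: cvg_nnsfun_approx.
have nf x : {homo (fun n => (f_ n x)%:E) : m n / (m <= n)%N >-> m <= n}.
  by move=> a b ab; rewrite lee_fin; exact/lefP/nd_nnsfun_approx.
transitivity (limn (fun n => \int[nu]_x (f_ n x)%:E)).
  rewrite -monotone_convergence//.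
  - by apply: eq_integral => x _; exact/esym/cvg_lim.
  - by move=> n; exact/measurable_EFinP.
  - by move=> n x _; rewrite lee_fin.
under eq_fun do rewrite integral_weighted_nnsfun.
rewrite -monotone_convergence//.
- apply: eq_integral => x _; apply/cvg_lim => //; exact: cvgeZr.
- by move=> n; apply: emeasurable_funM => //; exact/measurable_EFinP.
- by move=> n x _; rewrite mule_ge0// lee_fin.
- by move=> x _ a b ab; rewrite lee_wpmul2r ?lee_fin//; exact: nf.
Qed.

End weighted_measure.

(** Integrating [h o X] against a density amounts to integrating [h] against
    the image under [X] of the measure with that density, so a comparison on the
    events [X in A] is all that is needed. Both independence and conditional
    moments are exploited through this lemma. *)
Lemma ge0_le_integral_comp {R : realType} d d' (T : measurableType d)
    (S : measurableType d') (mu : {measure set T -> \bar R}) (X : T -> S)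
    (U V : T -> R) (h : S -> \bar R) :
  measurable_fun setT X ->
  measurable_fun setT U -> (forall x, 0 <= U x) ->
  measurable_fun setT V -> (forall x, 0 <= V x) ->
  (forall A, measurable A ->
    (\int[mu]_(x in X @^-1` A) (U x)%:E <=
     \int[mu]_(x in X @^-1` A) (V x)%:E)%E) ->
  measurable_fun setT h -> (forall y, 0 <= h y)%E ->
  (\int[mu]_x (h (X x) * (U x)%:E) <= \int[mu]_x (h (X x) * (V x)%:E))%E.
Proof.
move=> mX mU U0 mV V0 UV mh h0.
pose X' : {mfun T >-> S} := HB.pack X (isMeasurableFun.Build _ _ _ _ _ mX).
have mhX : measurable_fun setT (h \o X) by exact: measurableT_comp.
have E (W : T -> R) (mW : measurable_fun setT W) (W0 : forall x, 0 <= W x) :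
    (\int[mu]_x (h (X x) * (W x)%:E) =
     \int[pushforward (weighted mu mW W0) X']_y h y)%E.
  rewrite [RHS]ge0_integral_pushforward// preimage_setT ge0_integral_weighted//.
  by move=> x; exact: h0.
rewrite !E; apply: ge0_le_measure_integral => // A mA; exact: UV.
Qed.

(** * Independent observations *)

(** Independence speaks of indicators; they are replaced by the functions [F i]
    one index at a time. When [F k] is put in place, the product of the other
    factors is a density whose image under [Z k] is at most a multiple of
    the law of [Z k], by the previous stage applied to every event [Z k in A]. *)
Lemma mutually_independent_prod_le {R : realType} d d' (Omega : measurableType d)
    (S : measurableType d') (P : probability Omega R) n
    (Z : 'I_n -> Omega -> S) (F : 'I_n -> S -> R) (c : 'I_n -> R) :
  (forall i, measurable_fun setT (Z i)) -> mutually_independent P Z ->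
  (forall i, measurable_fun setT (F i)) -> (forall i x, 0 <= F i x) ->
  (forall i, \int[P]_w (F i (Z i w))%:E <= (c i)%:E)%E ->
  (\int[P]_w (\prod_i F i (Z i w))%:E <= (\prod_i c i)%:E)%E.
Proof.
move=> mZ indZ mF F0 Fc.
have c0 i : 0 <= c i.
  by rewrite -lee_fin (le_trans _ (Fc i))// integral_ge0// => w _; rewrite lee_fin.
have mprod (J : pred 'I_n) (G : 'I_n -> S -> R) :
    (forall i, measurable_fun setT (G i)) ->
    measurable_fun setT (fun w => \prod_(i | J i) G i (Z i w)).
  move=> mG; under eq_fun do rewrite big_mkcond.
  apply: measurable_prod => i _; case: (J i) => //.
  exact: measurableT_comp.
(* The family after [k] replacements. *)
pose H (A : 'I_n -> set S) k (i : 'I_n) : S -> R := if (i < k)%N then F i else \1_(A i).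
pose b (A : 'I_n -> set S) k (i : 'I_n) : R :=
  if (i < k)%N then c i else fine (P (Z i @^-1` A i)).
have mH A k i : measurable (A i) -> measurable_fun setT (H A k i).
  by rewrite /H; case: ifP.
have H0 A k i x : 0 <= H A k i x by rewrite /H; case: ifP.
have b0 A k i : 0 <= b A k i by rewrite /b; case: ifP => // _; rewrite fine_ge0.
have mpre i A : measurable A -> measurable (Z i @^-1` A).
  by move=> mA; rewrite -[X in measurable X]setTI; exact: mZ.
suff hyb k : (k <= n)%N -> forall A, (forall i, measurable (A i)) ->
    (\int[P]_w (\prod_i H A k i (Z i w))%:E <= (\prod_i b A k i)%:E)%E.
  have := hyb n (leqnn n) (fun=> setT) (fun=> measurableT).
  under eq_integral do under eq_bigr => i _ do rewrite /H ltn_ord.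
  by under [in X in (_ <= X)%E]eq_bigr => i _ do rewrite /b ltn_ord.
pose J : {set 'I_n} := finset.finset xpredT.
elim: k => [_ A mA|k IHk kn A mA].
  have prodE w : \prod_i H A 0 i (Z i w) =
      \1_(\bigcap_(i in [set` J]) (Z i @^-1` A i)) w.
    rewrite indicE /H /=; case: (boolP (w \in _)) => [|wA].
      rewrite inE => wA; rewrite big1// => i _.
      by rewrite indicE mem_set//; apply: wA; rewrite /= inE.
    have [i iA] : exists i, ~ A i (Z i w).
      by apply/existsNP => h; move/negP: wA; apply; rewrite inE => i _; exact: h.
    by rewrite (bigD1 i)//= indicE memNset// mul0r.
  under eq_integral do rewrite prodE.
  rewrite integral_indic//; last first.
    by apply: fin_bigcap_measurable => // i _; exact: mpre.
  rewrite setIT; apply: (le_trans (eqW (indZ J A mA))).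
  rewrite -prodEFin (eq_bigl xpredT); last by move=> i; rewrite inE.
  apply/eqW/eq_bigr => i _; rewrite /b fineK// fin_num_measure//; exact: mpre.
pose i0 := Ordinal kn.
pose A' B (i : 'I_n) : set S := if i == i0 then B else A i.
have mA' B : measurable B -> forall i, measurable (A' B i).
  by move=> mB i; rewrite /A'; case: ifP.
pose G w := \prod_(i | i != i0) H A k.+1 i (Z i w).
pose C := \prod_(i | i != i0) b A k.+1 i.
have ltE (i : 'I_n) : i != i0 -> (i < k.+1)%N = (i < k)%N.
  by move=> ii0; rewrite ltnS leq_eqVlt -[k]/(val i0) (inj_eq val_inj) (negbTE ii0).
have G0 w : 0 <= G w by exact: prodr_ge0.
have C0 : 0 <= C by exact: prodr_ge0.
have mG : measurable_fun setT G by apply: mprod => i; exact: mH.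
have step B : measurable B ->
    (\int[P]_(w in Z i0 @^-1` B) (G w)%:E <= \int[P]_(w in Z i0 @^-1` B) C%:E)%E.
  move=> mB; rewrite integral_cst; last exact: mpre.
  have := IHk (ltnW kn) (A' B) (mA' B mB).
  rewrite (bigD1 i0)//= {1}/b ltnn EFinM muleC /A' eqxx fineK; last first.
    by rewrite fin_num_measure//; exact: mpre.
  rewrite (eq_bigr (b A k.+1)); last first.
    by move=> i ii0; rewrite /b ltE// (negbTE ii0).
  move=> /(le_trans _); apply; rewrite integral_mkcond; apply/eqW/eq_integral => w _.
  have -> : \prod_i H (A' B) k i (Z i w) = \1_B (Z i0 w) * G w.
    rewrite (bigD1 i0)//=; congr (_ * _); first by rewrite /H /= ltnn /A' eqxx.
    by apply: eq_bigr => i ii0; rewrite /H ltE// /A' (negbTE ii0).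
  rewrite patchE indicE (_ : (w \in Z i0 @^-1` B) = (Z i0 w \in B))//.
  by case: ifP => _; rewrite ?mul1r ?mul0r.
have := @ge0_le_integral_comp R _ _ _ _ P (Z i0) G (cst C) (EFin \o F i0)
  (mZ i0) mG G0 (measurable_cst _) (fun=> C0) step.
move=> /(_ ((measurable_EFinP _ _).2 (mF i0)) (fun x => (F0 i0 x))).
under eq_integral => w _.
  rewrite /= -EFinM (_ : _ * _ = \prod_i H A k.+1 i (Z i w)); last first.
    by rewrite [RHS](bigD1 i0)//= {1}/H /= ltnSn.
  over.
move=> /le_trans; apply; rewrite /= ge0_integralZr//; last first.
- by move=> w _; rewrite lee_fin.
- by apply/measurable_EFinP; exact: measurableT_comp.
rewrite [X in (_ <= X%:E)%E](bigD1 i0)//= {1}/b ltnSn EFinM.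
by rewrite lee_wpmul2r ?lee_fin.
Qed.

(** * Exponential inequalities *)

Section exp_bounds.
Context {R : realType}.
Implicit Types x : R.

(** The right-hand side bounds a partial sum of the series. *)
Lemma expR_ge1DxDx2 x : 0 <= x -> 1 + x + x ^+ 2 / 2 <= expR x.
Proof.
move=> x0; have := @nondecreasing_cvgn_le R (series (exp_coeff x)) _ _ 3%N.
rewrite /series /= /index_iota /= !big_cons big_nil /exp_coeff /=.
rewrite expr0 expr1 !fact0 /= divr1 factS fact0 muln1 divr1 addr0 addrA.
apply; last exact: is_cvg_series_exp_coeff.
apply: nondecreasing_series => n _ _; exact: exp_coeff_ge0.
Qed.

Lemma expRN_le x : 0 <= x -> expR (- x) <= 1 - x + x ^+ 2 / 2.
Proof.
move=> x0; have h := expR_ge1DxDx2 x0.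
have e0 := expR_gt0 x.
rewrite expRN -[leLHS]mul1r ler_pdivrMr//.
have p0 : 0 <= 1 - x + x ^+ 2 / 2 by nra.
apply: (@le_trans _ _ ((1 - x + x ^+ 2 / 2) * (1 + x + x ^+ 2 / 2))).
  by have := sqr_ge0 (x ^+ 2); nra.
exact: ler_wpM2l.
Qed.

(** The sum of [`|x| ^+ k / k`!] over [k >= 2], by [exp_tail_series] below. *)
Definition exp_tail x := expR `|x| - 1 - `|x|.

Lemma exp_tail_ge0 x : 0 <= exp_tail x.
Proof. by rewrite /exp_tail; have := expR_ge1Dx `|x|; lra. Qed.

(** The linear term keeps its sign, so that it disappears on average for a centred
    variable. For negative [x = - y] the claim is [exp (- y) + 2 y <= exp y],
    where both sides are compared with [1 + y + y^2 / 2]. *)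
Lemma expR_le_tail x : expR x <= 1 + x + exp_tail x.
Proof.
rewrite /exp_tail; have [x0|x0] := leP 0 x; first by rewrite ger0_norm//; lra.
rewrite ltr0_norm//; have y0 : 0 <= - x by lra.
have := expRN_le y0; have := expR_ge1DxDx2 y0; rewrite opprK; lra.
Qed.

Lemma exp_tail_series x :
  (exp_tail x)%:E = (\sum_(k <oo) (`|x| ^+ k.+2 / k.+2`!%:R)%:E)%E.
Proof.
apply/esym/cvg_lim => //.
have -> : (fun n => \sum_(0 <= k < n) (`|x| ^+ k.+2 / k.+2`!%:R)%:E)%E =
    EFin \o (fun n => series (exp_coeff `|x|) (n + 2)%N - 1 - `|x|).
  apply/funext => n /=; rewrite sumEFin; congr EFin.
  rewrite /series /= addn2 big_nat_recl// big_nat_recl// /exp_coeff /=.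
  by rewrite expr0 expr1 fact0 divr1 (_ : 1`! = 1%N)// divr1; lra.
apply: cvg_EFin; first exact: nearW.
apply: cvgB; last exact: cvg_cst.
apply: cvgB; last exact: cvg_cst.
rewrite (cvg_shiftn 2 (series (exp_coeff `|x|))).
exact: is_cvg_series_exp_coeff.
Qed.

End exp_bounds.

(** * Conditional moments of the noise *)

Lemma integrable_bounded_mul {R : realType} d (T : measurableType d)
    (mu : {measure set T -> \bar R}) (h f : T -> R) (M : R) :
  measurable_fun setT h -> (forall x, `|h x| <= M) ->
  mu.-integrable setT (EFin \o f) ->
  mu.-integrable setT (fun x => (h x * f x)%:E).
Proof.
move=> mh hM fi; apply: (integrableMr _ mh _ fi) => //.
exists M; split; first exact: num_real.
by move=> N MN x _; exact: le_trans (hM x) (ltW MN).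
Qed.

Section conditional_moments.
Context {R : realType} d d' (Omega : measurableType d) (S : measurableType d').
Variables (P : probability Omega R) (X : Omega -> S) (eps : Omega -> R).
Hypotheses (mX : measurable_fun setT X) (meps : measurable_fun setT eps).

Let mpre A : measurable A -> measurable (X @^-1` A).
Proof. by move=> mA; rewrite -[X in measurable X]setTI; exact: mX. Qed.

Section center.
Hypothesis eps_center : is_cond_exp P eps X (cst 0).

Let ieps : P.-integrable setT (EFin \o eps).
Proof. by case: eps_center. Qed.

Let ep := eps ^\+.
Let en := eps ^\-.

Let mep : measurable_fun setT ep.
Proof. exact: measurable_funrpos. Qed.

Let men : measurable_fun setT en.
Proof. exact: measurable_funrneg. Qed.

Let ep0 x : 0 <= ep x.
Proof. exact: funrpos_ge0. Qed.

Let en0 x : 0 <= en x.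
Proof. exact: funrneg_ge0. Qed.

Let iep : P.-integrable setT (EFin \o ep).
Proof. by rewrite -funerpos; exact: integrable_funepos. Qed.

Let ien : P.-integrable setT (EFin \o en).
Proof. by rewrite -funerneg; exact: integrable_funeneg. Qed.

Let epn A : measurable A ->
  (\int[P]_(w in X @^-1` A) (ep w)%:E = \int[P]_(w in X @^-1` A) (en w)%:E)%E.
Proof.
move=> mA; case: eps_center => _ _ _ /(_ A mA).
rewrite integral0 => /esym.
under eq_integral do rewrite -[eps _](congr1 (fun f => f _) (funrposBneg eps)) EFinB.
have iA f : P.-integrable setT (EFin \o f) -> P.-integrable (X @^-1` A) (EFin \o f).
  by apply: integrableS => //; exact: mpre.
have fA f (fi : P.-integrable setT (EFin \o f)) :=
  integrable_fin_num (mpre mA) (iA f fi).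
rewrite integralB_EFin//; [|exact: mpre|exact: iA..] => h.
have := fA _ iep; have := fA _ ien; rewrite /= in h *.
move: h; case: (\int[P]_(w in _) (ep w)%:E)%E => // a.
by case: (\int[P]_(w in _) (en w)%:E)%E => // b [] /eqP; rewrite subr_eq0 => /eqP->.
Qed.

Let center_ge0 (h : S -> R) (M : R) :
  measurable_fun setT h -> (forall x, 0 <= h x <= M) ->
  (\int[P]_w (h (X w) * eps w)%:E = 0)%E.
Proof.
move=> mh hM; have h0 x : 0 <= h x by case/andP: (hM x).
have mhX : measurable_fun setT (h \o X) by exact: measurableT_comp.
have bhX w : `|h (X w)| <= M by rewrite ger0_norm//; case/andP: (hM (X w)).
have mhe : measurable_fun setT (EFin \o h) by exact/measurable_EFinP.
have E : (\int[P]_w (h (X w) * ep w)%:E = \int[P]_w (h (X w) * en w)%:E)%E.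
  apply/eqP; rewrite eq_le; apply/andP; split.
    by apply: (ge0_le_integral_comp mX mep ep0 men en0 _ mhe) => [A mA|x];
      [rewrite epn|rewrite lee_fin].
  by apply: (ge0_le_integral_comp mX men en0 mep ep0 _ mhe) => [A mA|x];
    [rewrite epn|rewrite lee_fin].
under eq_integral do
  rewrite -[eps _](congr1 (fun f => f _) (funrposBneg eps)) mulrBr EFinB.
have i1 := integrable_bounded_mul mhX bhX iep.
have i2 := integrable_bounded_mul mhX bhX ien.
rewrite integralB_EFin// E subee//; exact: integrable_fin_num.
Qed.

(** The positive and negative parts of [eps] have the same integral over each event
    [X in A], hence against each nonnegative function of [X]; a constant added
    to [h] removes the sign condition. *)
Lemma integral_bounded_mul_center (h : S -> R) (M : R) :
  measurable_fun setT h -> (forall x, `|h x| <= M) ->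
  (\int[P]_w (h (X w) * eps w)%:E = 0)%E.
Proof.
move=> mh hM.
have mhX : measurable_fun setT (h \o X) by exact: measurableT_comp.
have i1 : P.-integrable setT (fun w => ((h (X w) + M) * eps w)%:E).
  apply: (@integrable_bounded_mul _ _ _ _ _ _ (M + M)) => //.
    exact: measurable_funD.
  move=> w; rewrite (le_trans (ler_normD _ _))// lerD// ger0_norm//.
  exact: le_trans (hM (X w)).
have i2 : P.-integrable setT (fun w => (M * eps w)%:E).
  by under eq_fun do rewrite EFinM; exact: integrableZl.
have -> : (\int[P]_w (h (X w) * eps w)%:E =
    \int[P]_w (((h (X w) + M) * eps w)%:E - (M * eps w)%:E))%E.
  by apply: eq_integral => w _; rewrite -EFinB -mulrBl addrK.
rewrite integralB_EFin// (@center_ge0 (fun x => h x + M) (M + M)); first last.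
- by move=> x; have := hM x; rewrite ler_norml => /andP[? ?]; apply/andP; split; lra.
- exact: measurable_funD.
have [M0|M0] := leP 0 M.
  rewrite (@center_ge0 (cst M) M) ?subee//.
  by move=> x; rewrite M0 lexx.
rewrite (eq_integral (fun=> 0)%E) ?integral0 ?sube0//.
by move=> w _; have := le_trans (normr_ge0 _) (hM (X w)); rewrite leNgt M0.
Qed.

End center.

(** Over an event [X in A] the integral of [`|eps| ^+ k] is that of the version of
    the conditional expectation, which is almost surely at most [c]. *)
Lemma integral_mul_cond_le (k : nat) (c : R) (h : S -> R) :
  cond_exp_le P (fun w => `|eps w| ^+ k) X c ->
  measurable_fun setT h -> (forall x, 0 <= h x) ->
  (\int[P]_w (h (X w) * `|eps w| ^+ k)%:E <= \int[P]_w (h (X w) * c)%:E)%E.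
Proof.
move=> [g [ie mg ig gE] gc] mh h0.
have mhe : measurable_fun setT (EFin \o h) by exact/measurable_EFinP.
have me : measurable_fun setT (fun w => `|eps w| ^+ k).
  by apply: measurable_funX; exact: measurableT_comp.
have e0 w : 0 <= `|eps w| ^+ k by exact: exprn_ge0.
have mgX : measurable_fun setT (g \o X) by exact: measurableT_comp.
have leA A : measurable A -> (\int[P]_(w in X @^-1` A) (`|eps w| ^+ k)%:E <=
    \int[P]_(w in X @^-1` A) c%:E)%E.
  move=> mA; rewrite -gE//.
  (* The truncation of [g] at [c] turns the almost sure bound into a sure one. *)
  rewrite (ae_eq_integral (fun w => (minr (g (X w)) c)%:E))//.
  - apply: le_integral.
    + exact: mpre.
    + apply: (@integrableS _ _ _ _ setT) => //; first exact: mpre.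
      have ic := finite_measure_integrable_cst P c measurableT.
      apply: le_integrable (integrableD _ (integrable_abse ig) (integrable_abse ic)) => //.
        by apply/measurable_EFinP; exact: measurable_minr.
      move=> w _ /=; rewrite lee_fin (ger0_norm (addr_ge0 _ _))//.
      by rewrite /minr; case: ifP => _; rewrite ?lerDl ?lerDr.
    + apply: (@integrableS _ _ _ _ setT) => //; first exact: mpre.
      exact: finite_measure_integrable_cst.
    + by move=> w _; rewrite lee_fin ge_min lexx orbT.
  - exact: mpre.
  - by apply: measurable_funTS; exact/measurable_EFinP.
  - apply: measurable_funTS; apply/measurable_EFinP; exact: measurable_minr.
  - apply: filterS gc => w gw _; congr EFin; exact/esym/min_idPl.
have c0 : 0 <= c.
  have := leA _ measurableT.
  rewrite preimage_setT [leRHS]integral_cst// [X in (_ * X)%E]probability_setT mule1.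
  rewrite -lee_fin; apply: le_trans; apply: integral_ge0 => w _.
  by rewrite lee_fin.
exact: (ge0_le_integral_comp mX me e0 (measurable_cst c) (fun=> c0) leA mhe).
Qed.

End conditional_moments.

(** * Exponential moments of the noise *)

Lemma integrable_bounded {R : realType} d (T : measurableType d)
    (P : probability T R) (f : T -> R) (M : R) :
  measurable_fun setT f -> (forall x, `|f x| <= M) ->
  P.-integrable setT (EFin \o f).
Proof.
move=> mf fM; apply: measurable_bounded_integrable => //.
  by rewrite [ltLHS]probability_setT ltry.
exists M; split; first exact: num_real.
by move=> N MN x _; exact: le_trans (fM x) (ltW MN).
Qed.

Section bernstein.
Context {R : realType} d d' (Omega : measurableType d) (S : measurableType d').
Variables (P : probability Omega R) (X : Omega -> S) (eps : Omega -> R).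
Variables (sigma varsigma : R).
Hypotheses (mX : measurable_fun setT X) (meps : measurable_fun setT eps).
Hypothesis varsigma0 : 0 < varsigma.
Hypothesis eps_center : is_cond_exp P eps X (cst 0).
Hypothesis eps_moment : forall k, (2 <= k)%N ->
  cond_exp_le P (fun w => `|eps w| ^+ k) X
    (k`!%:R / 2 * sigma ^+ 2 * varsigma ^+ (k - 2)).

Let geometric_quarter (a : R) :
  (\sum_(k <oo) (a * 4^-1 ^+ k)%:E = (4 / 3 * a)%:E)%E.
Proof.
apply/cvg_lim => //.
have -> : (fun n => \sum_(0 <= k < n) (a * 4^-1 ^+ k)%:E)%E =
    EFin \o series (geometric a (4^-1 : R)).
  by apply/funext => n /=; rewrite sumEFin.
apply: cvg_EFin; first exact: nearW.
rewrite (_ : 4 / 3 * a = a * (1 - 4^-1)^-1); last by field.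
by apply: cvg_geometric_series; rewrite ger0_norm//; lra.
Qed.

(** The [k]-th term of the series is controlled by the conditional moment of order
    [k + 2]. Because [`|u| * varsigma <= 1/4], these bounds are dominated by a
    geometric series of ratio [1/4], whose sum is [4/3] times its first term
    [w u^2 sigma^2 / 2]. *)
Lemma integral_exp_tail_le (w u : S -> R) :
  measurable_fun setT w -> measurable_fun setT u ->
  (forall x, 0 <= w x) -> (forall x, `|u x| * varsigma <= 4^-1) ->
  (\int[P]_z (w (X z) * exp_tail (u (X z) * eps z))%:E <=
   \int[P]_z (w (X z) * (2 / 3 * sigma ^+ 2 * u (X z) ^+ 2))%:E)%E.
Proof.
move=> mw mu w0 uv.
pose q x := w x * u x ^+ 2 * sigma ^+ 2 / 2.
have q0 x : 0 <= q x by rewrite /q divr_ge0// mulr_ge0 ?sqr_ge0// mulr_ge0 ?sqr_ge0.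
pose h k x := w x * `|u x| ^+ k.+2 / k.+2`!%:R.
have h0 k x : 0 <= h k x by rewrite /h divr_ge0// mulr_ge0// exprn_ge0.
have mh k : measurable_fun setT (h k).
  apply: measurable_funM => //; apply: measurable_funM => //.
  by apply: measurable_funX; exact: measurableT_comp.
have mq : measurable_fun setT q.
  do 2 apply: measurable_funM => //; apply: measurable_funM => //.
  exact: measurable_funX.
have mhX k : measurable_fun setT (fun z => h k (X z) * `|eps z| ^+ k.+2).
  apply: measurable_funM; first exact: measurableT_comp.
  by apply: measurable_funX; exact: measurableT_comp.
have -> : (\int[P]_z (w (X z) * exp_tail (u (X z) * eps z))%:E =
    \sum_(k <oo) \int[P]_z (h k (X z) * `|eps z| ^+ k.+2)%:E)%E.
  rewrite -integral_nneseries//; last 2 first.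
  - by move=> k; exact/measurable_EFinP.
  - by move=> k z _; rewrite lee_fin mulr_ge0// exprn_ge0.
  apply: eq_integral => z _; rewrite EFinM exp_tail_series -nneseriesZl; last first.
    by move=> k _; rewrite lee_fin divr_ge0// exprn_ge0.
  apply: eq_eseriesr => k _; rewrite -EFinM normrM exprMn; congr EFin.
  by rewrite /h; ring.
have -> : (\int[P]_z (w (X z) * (2 / 3 * sigma ^+ 2 * u (X z) ^+ 2))%:E =
    \sum_(k <oo) \int[P]_z (q (X z) * 4^-1 ^+ k)%:E)%E.
  rewrite -integral_nneseries//; last 2 first.
  - move=> k; apply/measurable_EFinP; apply: measurable_funM => //.
    exact: measurableT_comp.
  - by move=> k z _; rewrite lee_fin mulr_ge0// exprn_ge0// invr_ge0.
  apply: eq_integral => z _; rewrite geometric_quarter; congr EFin.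
  by rewrite /q; field.
apply: lee_nneseries => [k _ _|k _].
  by apply: integral_ge0 => z _; rewrite lee_fin mulr_ge0// exprn_ge0.
have := integral_mul_cond_le mX meps (eps_moment (isT : 2 <= k.+2)%N) (mh k) (h0 k).
move=> /le_trans; apply; apply: ge0_le_integral => //.
- move=> z _; rewrite lee_fin; apply: mulr_ge0 => //.
  by rewrite mulr_ge0 ?exprn_ge0 ?(ltW varsigma0)// mulr_ge0 ?sqr_ge0// divr_ge0.
- apply/measurable_EFinP; apply: measurable_funM => //; exact: measurableT_comp.
- apply/measurable_EFinP; apply: measurable_funM => //; exact: measurableT_comp.
move=> z _; rewrite lee_fin subn2 /=.
have f0 : k.+2`!%:R != 0 :> R by rewrite pnatr_eq0 -lt0n fact_gt0.
have -> : h k (X z) * (k.+2`!%:R / 2 * sigma ^+ 2 * varsigma ^+ k) =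
    q (X z) * (`|u (X z)| * varsigma) ^+ k.
  rewrite /h /q exprMn -[u _ ^+ 2]real_normK ?num_real// !exprS; field.
  exact: f0.
apply: ler_wpM2l => //; apply: lerXn2r => //; rewrite nnegrE.
  by rewrite mulr_ge0// ltW.
by rewrite invr_ge0.
Qed.

(** Bernstein's bound on the exponential moment: the term of order one of
    [expR_le_tail] has mean zero and the tail is quadratic in [u]. *)
Lemma integral_exp_le (w u : S -> R) (M : R) :
  measurable_fun setT w -> measurable_fun setT u ->
  (forall x, 0 <= w x <= M) -> (forall x, `|u x| * varsigma <= 4^-1) ->
  (\int[P]_z (w (X z) * expR (u (X z) * eps z))%:E <=
   \int[P]_z (w (X z) * (1 + 2 / 3 * sigma ^+ 2 * u (X z) ^+ 2))%:E)%E.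
Proof.
move=> mw mu wM uv.
have w0 x : 0 <= w x by case/andP: (wM x).
have bw x : `|w x| <= M by rewrite ger0_norm//; case/andP: (wM x).
pose U := (4 * varsigma)^-1.
have bu x : `|u x| <= U by rewrite /U invfM ler_pdivlMr.
have mwX : measurable_fun setT (w \o X) by exact: measurableT_comp.
have muX : measurable_fun setT (u \o X) by exact: measurableT_comp.
have mv : measurable_fun setT (fun x => w x * u x) by exact: measurable_funM.
have bv x : `|w x * u x| <= M * U by rewrite normrM ler_pM.
pose V z := w (X z) * (2 / 3 * sigma ^+ 2 * u (X z) ^+ 2).
have mV : measurable_fun setT V.
  by apply: measurable_funM => //; apply: measurable_funM => //; exact: measurable_funX.
have V0 z : 0 <= V z by rewrite /V mulr_ge0// mulr_ge0 ?sqr_ge0// mulr_ge0 ?sqr_ge0// divr_ge0.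
have i1 : P.-integrable setT (fun z => (w (X z))%:E).
  exact: (integrable_bounded P mwX (fun z => bw (X z))).
have iV : P.-integrable setT (EFin \o V).
  apply: (@integrable_bounded_mul _ _ _ P (w \o X)
    (fun z => 2 / 3 * sigma ^+ 2 * u (X z) ^+ 2) M) => //; first by move=> z; exact: bw.
  apply: (@integrable_bounded _ _ _ P (fun z => 2 / 3 * sigma ^+ 2 * u (X z) ^+ 2)
    (2 / 3 * sigma ^+ 2 * U ^+ 2)).
  - apply: measurable_funM; first exact: measurable_cst.
    exact: measurable_funX.
  - have a0 : 0 <= 2 / 3 * sigma ^+ 2 by rewrite mulr_ge0 ?sqr_ge0.
    move=> z; rewrite ger0_norm; last by rewrite mulr_ge0 ?sqr_ge0.
    apply: ler_wpM2l => //; rewrite -[leLHS]real_normK ?num_real//.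
    by apply: lerXn2r => //; rewrite nnegrE invr_ge0 mulr_ge0// ltW.
have ive : P.-integrable setT (fun z => (w (X z) * u (X z) * eps z)%:E).
  apply: (@integrable_bounded_mul _ _ _ P (fun z => w (X z) * u (X z)) eps (M * U)) => //.
    by exact: measurable_funM.
  by case: eps_center.
pose T z := w (X z) * exp_tail (u (X z) * eps z).
have mT : measurable_fun setT T.
  apply: measurable_funM => //; rewrite /exp_tail.
  have mn : measurable_fun setT (fun z => `|u (X z) * eps z|).
    by apply: measurableT_comp => //; exact: measurable_funM.
  apply: measurable_funB => //; apply: measurable_funB => //.
  exact: measurableT_comp.
have T0 z : 0 <= T z by rewrite mulr_ge0// exp_tail_ge0.
have TV : (\int[P]_z (T z)%:E <= \int[P]_z (V z)%:E)%E by exact: integral_exp_tail_le.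
have iT : P.-integrable setT (EFin \o T).
  apply/integrableP; split; first exact/measurable_EFinP.
  under eq_integral do rewrite /= ger0_norm//.
  by rewrite (le_lt_trans TV)//; exact: integrable_lty.
apply: (@le_trans _ _
    (\int[P]_z ((w (X z))%:E + (w (X z) * u (X z) * eps z)%:E + (T z)%:E))%E).
  have le1 z : w (X z) * expR (u (X z) * eps z) <= w (X z) + w (X z) * u (X z) * eps z + T z.
    have := ler_wpM2l (w0 (X z)) (expR_le_tail (u (X z) * eps z)).
    by rewrite /T; lra.
  apply: ge0_le_integral => //.
  - by move=> z _; rewrite lee_fin mulr_ge0// expR_ge0.
  - apply/measurable_EFinP; apply: measurable_funM => //.
    by apply: measurableT_comp => //; exact: measurable_funM.
  - do 2 (apply: emeasurable_funD; last by [exact/measurable_EFinP| exact: measurable_int ive]).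
    exact/measurable_EFinP.
  - by move=> z _; rewrite -!EFinD lee_fin.
rewrite integralD//; last exact: integrableD.
rewrite integralD// (integral_bounded_mul_center mX meps eps_center mv bv) adde0.
apply: (le_trans (leeD2l _ TV)).
rewrite -integralD//; apply/eqW/eq_integral => z _.
by rewrite -EFinD /V; congr EFin; ring.
Qed.

End bernstein.

(** * Exponential moments of the loss *)

Section loss_exponential_moments.
Context {R : realType} d d' (Omega : measurableType d) (S : measurableType d').
Variables (P : probability Omega R) (X : Omega -> S) (eps : Omega -> R).
Variables (sigma varsigma C t : R).
Hypotheses (mX : measurable_fun setT X) (meps : measurable_fun setT eps).
Hypotheses (varsigma0 : 0 < varsigma) (t0 : 0 < t).
Hypothesis eps_center : is_cond_exp P eps X (cst 0).
Hypothesis eps_moment : forall k, (2 <= k)%N ->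
  cond_exp_le P (fun w => `|eps w| ^+ k) X
    (k`!%:R / 2 * sigma ^+ 2 * varsigma ^+ (k - 2)).
Hypotheses (tsigma : t * sigma ^+ 2 <= 16^-1) (tC : t * C ^+ 2 <= 48^-1).
Hypothesis tvarsigma : t * C * varsigma <= 16^-1.

Variables (g : S -> R) (e : R).
Hypotheses (mg : measurable_fun setT g) (gC : forall x, `|g x| <= 2 * C).
Hypothesis gE : (\int[P]_z (g (X z) ^+ 2)%:E = e%:E)%E.

Let g2C x : g x ^+ 2 <= 4 * C ^+ 2.
Proof. by have := gC x; rewrite ler_norml => /andP[? ?]; nra. Qed.

Let x12 x : 0 <= t * g x ^+ 2 <= 12^-1.
Proof.
apply/andP; split; first by rewrite mulr_ge0 ?sqr_ge0// ltW.
have := ler_wpM2l (ltW t0) (g2C x).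
have -> : t * (4 * C ^+ 2) = 4 * (t * C ^+ 2) by ring.
move: tC; lra.
Qed.

Let uv c x : `|c| = 2 -> `|c * t * g x| * varsigma <= 4^-1.
Proof.
move=> c2; rewrite !normrM c2 (ger0_norm (ltW t0)).
have h := ler_wpM2l (ltW t0) (ler_wpM2r (ltW varsigma0) (gC x)).
by move: tvarsigma h; rewrite !mulrA; lra.
Qed.

Let msq : measurable_fun setT (fun x => t * g x ^+ 2).
Proof. by apply: measurable_funM => //; exact: measurable_funX. Qed.

Let integral_affine c : (forall x, 0 <= 1 + c * (t * g x ^+ 2)) ->
  (\int[P]_z (1 + c * (t * g (X z) ^+ 2))%:E = (1 + c * (t * e))%:E)%E.
Proof.
move=> c0.
have i2 : P.-integrable setT (fun z => (g (X z) ^+ 2)%:E).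
  apply: (@integrable_bounded _ _ _ P (fun z => g (X z) ^+ 2) (4 * C ^+ 2)).
    by apply: measurable_funX; exact: measurableT_comp.
  by move=> z; rewrite ger0_norm ?sqr_ge0.
under eq_integral do rewrite mulrA EFinD EFinM.
rewrite integralD//; last 2 first.
- exact: finite_measure_integrable_cst.
- exact: integrableZl.
rewrite integral_cst// [X in (_ * X)%E]probability_setT mule1.
by rewrite integralZl// gE -EFinM -EFinD mulrA.
Qed.

(** Bernstein's bound with weight [exp (- x)] and [u = - 2 t g], where
    [x = t g^2 <= 1/12], leaves [exp (- x) (1 + x / 6)], which is at most
    [1 - 3/4 x]; then [1 - y <= exp (- y)] after integration. *)
Lemma integral_expRN_excess_le :
  (\int[P]_z (expR (- (t * (g (X z) ^+ 2 + 2 * g (X z) * eps z))))%:E <=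
   (expR (- (3 / 4 * (t * e))))%:E)%E.
Proof.
pose w x := expR (- (t * g x ^+ 2)); pose u x := - 2 * t * g x.
have mw : measurable_fun setT w.
  by apply: measurableT_comp => //; exact: measurableT_comp.
have mu : measurable_fun setT u by exact: measurable_funM.
have w1 x : 0 <= w x <= 1.
  by rewrite expR_ge0 -[leRHS]expR0 ler_expR lerNl oppr0; case/andP: (x12 x).
have uv' x : `|u x| * varsigma <= 4^-1 by apply: uv; rewrite normrN ger0_norm.
have := integral_exp_le mX meps varsigma0 eps_center eps_moment mw mu w1 uv'.
under eq_integral => z _.
  rewrite -expRD (_ : _ + _ = - (t * (g (X z) ^+ 2 + 2 * g (X z) * eps z))); last first.
    by rewrite /u; ring.
  over.
move=> /le_trans; apply.
apply: (@le_trans _ _ (1 + (- (3 / 4)) * (t * e))%:E); last first.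
  by rewrite lee_fin (le_trans _ (expR_ge1Dx _))//; lra.
rewrite -integral_affine; last by move=> x; have := x12 x; lra.
have mXg : measurable_fun setT (fun z => t * g (X z) ^+ 2).
  exact: (measurableT_comp msq mX).
apply: ge0_le_integral => //.
- move=> z _; rewrite lee_fin mulr_ge0 ?expR_ge0// addr_ge0//.
  by rewrite mulr_ge0 ?sqr_ge0// mulr_ge0 ?sqr_ge0.
- apply/measurable_EFinP; apply: measurable_funM; first exact: measurableT_comp.
  apply: measurable_funD => //; apply: measurable_funM => //.
  by apply: measurable_funX; exact: measurableT_comp.
- apply/measurable_EFinP; apply: measurable_funD => //; exact: measurable_funM.
move=> z _; rewrite lee_fin; have /andP[y0 y1] := x12 (X z).
set y := t * g (X z) ^+ 2 in y0 y1 *.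
have -> : w (X z) = expR (- y) by [].
have h : 1 + 2 / 3 * sigma ^+ 2 * u (X z) ^+ 2 <= 1 + y / 6.
  have -> : 2 / 3 * sigma ^+ 2 * u (X z) ^+ 2 = (t * sigma ^+ 2) * (8 / 3 * y).
    by rewrite /u /y; field.
  have := ler_wpM2r (_ : 0 <= 8 / 3 * y) tsigma; lra.
apply: (le_trans (ler_wpM2l (expR_ge0 _) h)).
have h6 : 0 <= 1 + y / 6 by lra.
apply: (le_trans (ler_wpM2r h6 (expRN_le y0))); nra.
Qed.

(** As for the negative exponent, now with
    [exp x (1 + x / 6) <= (1 + x / 6) / (1 - x) <= 1 + 4/3 x]. *)
Lemma integral_expR_excess_le :
  (\int[P]_z (expR (t * (g (X z) ^+ 2 + 2 * g (X z) * eps z)))%:E <=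
   (expR (4 / 3 * (t * e)))%:E)%E.
Proof.
pose w x := expR (t * g x ^+ 2); pose u x := 2 * t * g x.
have mw : measurable_fun setT w by exact: measurableT_comp.
have mu : measurable_fun setT u by exact: measurable_funM.
have w1 x : 0 <= w x <= expR 12^-1.
  by rewrite expR_ge0 ler_expR; case/andP: (x12 x).
have uv' x : `|u x| * varsigma <= 4^-1 by apply: uv; rewrite ger0_norm.
have := integral_exp_le mX meps varsigma0 eps_center eps_moment mw mu w1 uv'.
under eq_integral => z _.
  rewrite -expRD (_ : _ + _ = t * (g (X z) ^+ 2 + 2 * g (X z) * eps z)); last first.
    by rewrite /u; ring.
  over.
move=> /le_trans; apply.
apply: (@le_trans _ _ (1 + 4 / 3 * (t * e))%:E); last first.
  by rewrite lee_fin (le_trans _ (expR_ge1Dx _)).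
rewrite -integral_affine; last by move=> x; have := x12 x; lra.
have mXg : measurable_fun setT (fun z => t * g (X z) ^+ 2).
  exact: (measurableT_comp msq mX).
apply: ge0_le_integral => //.
- move=> z _; rewrite lee_fin mulr_ge0 ?expR_ge0// addr_ge0//.
  by rewrite mulr_ge0 ?sqr_ge0// mulr_ge0 ?sqr_ge0.
- apply/measurable_EFinP; apply: measurable_funM; first exact: measurableT_comp.
  apply: measurable_funD => //; apply: measurable_funM => //.
  by apply: measurable_funX; exact: measurableT_comp.
- apply/measurable_EFinP; apply: measurable_funD => //; exact: measurable_funM.
move=> z _; rewrite lee_fin; have /andP[y0 y1] := x12 (X z).
set y := t * g (X z) ^+ 2 in y0 y1 *.
have -> : w (X z) = expR y by [].
have h : 1 + 2 / 3 * sigma ^+ 2 * u (X z) ^+ 2 <= 1 + y / 6.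
  have -> : 2 / 3 * sigma ^+ 2 * u (X z) ^+ 2 = (t * sigma ^+ 2) * (8 / 3 * y).
    by rewrite /u /y; field.
  have := ler_wpM2r (_ : 0 <= 8 / 3 * y) tsigma; lra.
apply: (le_trans (ler_wpM2l (expR_ge0 _) h)).
have e1 : expR y * (1 - y) <= 1.
  have := ler_wpM2l (expR_ge0 y) (expR_ge1Dx (- y)).
  by rewrite -expRD subrr expR0; lra.
have e0 := expR_ge0 y; nra.
Qed.

End loss_exponential_moments.

(** * Product laws, uniform and normal masses *)

Lemma measurable_box d (T : measurableType d) n (A : 'I_n -> set T) :
  (forall i, measurable (A i)) ->
  measurable [set x : n.-tuple T | forall i, A i (tnth x i)].
Proof.
move=> mA; rewrite [X in measurable X](_ : _ =
    \bigcap_(i in [set: 'I_n]) ((@tnth _ T)^~ i @^-1` A i)); last first.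
  by apply/seteqP; split => x /= h i; [move=> _; exact: h|exact: (h i)].
apply: fin_bigcap_measurable => // i _; rewrite -[X in measurable X]setTI.
exact: measurable_tnth.
Qed.

Lemma power_prob_box {R : realType} d (T : measurableType d)
    (P : probability T R) n (A : 'I_n -> set T) :
  (forall i, measurable (A i)) ->
  power_prob P n [set x | forall i, A i (tnth x i)] = (\prod_i P (A i))%E.
Proof.
elim: n A => [|n IHn] A mA /=.
  rewrite big_ord0 [LHS]diracE mem_set//= => -[]//.
rewrite big_ord_recl -(IHn (fun i => A (lift ord0 i))); last by move=> i; exact: mA.
rewrite -product_measure1E//; last first.
  by apply: (@measurable_box _ _ n (fun i => A (lift ord0 i))) => i.
congr (_ _).
apply/seteqP; split => -[a x] /=.
  by move=> h; split=> [|i]; [exact: (h ord0)|have := h (lift ord0 i); rewrite tnthS].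
move=> [h0 h] i; case: (unliftP ord0 i) => [j ->|->]//; rewrite tnthS; exact: h.
Qed.

Lemma cubeE {R : realType} d : (cube : set (d.-tuple R)) =
  [set x | forall i, [set` `[0, 1]%R] (tnth x i)].
Proof. by apply/seteqP; split => x /= h i; have := h i; rewrite in_itv. Qed.

Lemma measurable_cube {R : realType} d : measurable (cube : set (d.-tuple R)).
Proof.
rewrite cubeE; apply: (@measurable_box _ _ d (fun=> _)) => i.
exact: measurable_itv.
Qed.

Lemma uniform_cube1 {R : realType} d : uniform_cube (cube : set (d.-tuple R)) = 1%E.
Proof.
have := @power_prob_box R _ _ (@uniform01 R) d (fun=> `[0, 1]%classic)
  (fun=> measurable_itv _).
rewrite cubeE => h. apply: (etrans h); rewrite big1// => i _.
exact: integral_uniform_pdf1.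
Qed.

Section normal_mass.
Context {R : realType}.

Lemma std_normal_pdf_gt0 (x : R) : 0 < normal_pdf 0 1 x.
Proof.
rewrite normal_pdfE ?oner_eq0// mulr_gt0 ?expR_gt0//.
by rewrite normal_peak_gt0 ?oner_eq0.
Qed.

Lemma std_normal_pdf_le (x B : R) : `|x| <= B -> normal_pdf 0 1 B <= normal_pdf 0 1 x.
Proof.
move=> xB; rewrite !normal_pdfE ?oner_eq0//= ler_wpM2l ?normal_peak_ge0//.
rewrite /normal_fun ler_expR !subr0 expr1n ler_wpM2r// lerN2.
rewrite -[leLHS]real_normK ?num_real//; apply: lerXn2r => //; rewrite nnegrE//.
exact: le_trans xB.
Qed.

Lemma std_normal_itv_ge (a b B : R) : a <= b -> - B <= a -> b <= B ->
  (((b - a) * normal_pdf 0 1 B)%:E <= std_normal `[a, b]%classic)%E.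
Proof.
move=> ab Ba bB.
have -> : std_normal `[a, b]%classic =
  (\int[lebesgue_measure]_(x in `[a, b]%classic) (normal_pdf 0 1 x)%:E)%E by [].
apply: (@le_trans _ _
    (\int[lebesgue_measure]_(x in `[a, b]%classic) (normal_pdf 0 1 B)%:E)%E).
  rewrite integral_cst//= lebesgue_measure_itv/= lte_fin.
  have [ab'|ba] := ltP a b; first by rewrite -EFinB -EFinM mulrC.
  by rewrite (_ : b - a = 0) ?mul0r ?mule0//; lra.
apply: ge0_le_integral => //.
- by move=> x _; rewrite lee_fin normal_pdf_ge0.
- apply: measurable_funTS; apply/measurable_EFinP; exact: measurable_normal_pdf.
move=> x /=; rewrite in_itv/= => /andP[? ?]; rewrite lee_fin std_normal_pdf_le//.
by rewrite ler_norml; apply/andP; split; lra.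
Qed.

End normal_mass.

(** * Excess risk in the regression model *)

Lemma sup_norm_le {R : realType} d (f : d.-tuple R -> R) (C : R) x :
  (sup_norm f <= C%:E)%E -> cube x -> `|f x| <= C.
Proof.
move=> fC xc; rewrite -lee_fin (le_trans _ fC)//; apply: ereal_sup_ubound.
by exists x.
Qed.

Section regression_risk.
Context {R : realType} (d : nat) d0 (Omega : measurableType d0).
Variables (P : probability Omega R) (Z : {RV P >-> (R * d.-tuple R)%type}).
Variables (f0 : d.-tuple R -> R) (sigma varsigma C : R).
Hypothesis model : regression_model f0 sigma varsigma Z.
Hypotheses (C0 : 0 < C) (f0C : (sup_norm f0 <= C%:E)%E).

Let X w := (Z w).2.
Let eps w := (Z w).1 - f0 (X w).

Let mf0 : measurable_fun setT f0.
Proof. by case: model. Qed.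

Let mX : measurable_fun setT X.
Proof. by apply: measurableT_comp => //; exact: measurable_funP. Qed.

Let mY : measurable_fun setT (fun w => (Z w).1).
Proof. by apply: measurableT_comp => //; exact: measurable_funP. Qed.

Let meps : measurable_fun setT eps.
Proof. by apply: measurable_funB => //; exact: measurableT_comp. Qed.

Let eps_center : is_cond_exp P eps X (cst 0).
Proof. by case: model. Qed.

Let X_cube : {ae P, forall w, cube (X w)}.
Proof.
have mpre : measurable (X @^-1` cube).
  by rewrite -[X in measurable X]setTI; apply: mX => //; exact: measurable_cube.
exists (~` (X @^-1` cube)); split => //; first exact: measurableC.
rewrite [LHS]probability_setC//; case: model => _ -> //; last exact: measurable_cube.
by rewrite uniform_cube1 subee.
Qed.

(** The squared distance of [f] to [f0] in L2 of the law of [X]. *)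
Definition sq_dist (f : d.-tuple R -> R) : R :=
  fine (\int[P]_w ((f0 (Z w).2 - f (Z w).2) ^+ 2)%:E)%E.

Definition excess_loss (f : d.-tuple R -> R) (z : R * d.-tuple R) : R :=
  (z.1 - f z.2) ^+ 2 - (z.1 - f0 z.2) ^+ 2.

Section one_predictor.
Variable f : d.-tuple R -> R.
Hypotheses (mf : measurable_fun setT f) (fC : (sup_norm f <= C%:E)%E).

(* The bounds on [f] and [f0] hold on the cube only; [X] is in it almost surely. *)
Let g x := (f0 x - f x) * \1_cube x.

Let mg : measurable_fun setT g.
Proof.
apply: measurable_funM; first exact: measurable_funB.
by apply: measurable_indic; exact: measurable_cube.
Qed.

Let gC x : `|g x| <= 2 * C.
Proof.
rewrite /g indicE; have [|xc] := boolP (x \in cube); last first.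
  by rewrite mulr0 normr0 mulr_ge0// ltW.
rewrite inE mulr1 => xc; rewrite (le_trans (ler_normB _ _))//.
have := sup_norm_le f0C xc; have := sup_norm_le fC xc; lra.
Qed.

Let gE : {ae P, forall w, f0 (X w) - f (X w) = g (X w)}.
Proof.
by apply: filterS X_cube => w wc; rewrite /g indicE mem_set// mulr1.
Qed.

Let mfX : measurable_fun setT (f \o X).
Proof. exact: measurableT_comp. Qed.
Let mf0X : measurable_fun setT (f0 \o X).
Proof. exact: measurableT_comp. Qed.
Let mgX : measurable_fun setT (g \o X).
Proof. exact: measurableT_comp. Qed.

Let g2C x : `|g x ^+ 2| <= 4 * C ^+ 2.
Proof.
by rewrite ger0_norm ?sqr_ge0//; have := gC x; rewrite ler_norml => /andP[? ?]; nra.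
Qed.

Let ig2 : P.-integrable setT (fun w => (g (X w) ^+ 2)%:E).
Proof.
apply: (@integrable_bounded _ _ _ P (fun w => g (X w) ^+ 2) (4 * C ^+ 2)) => //.
exact: measurable_funX.
Qed.

Let int_gap : (\int[P]_w ((f0 (X w) - f (X w)) ^+ 2)%:E =
  \int[P]_w (g (X w) ^+ 2)%:E)%E.
Proof.
apply: ae_eq_integral => //.
- by apply/measurable_EFinP; apply: measurable_funX; exact: measurable_funB.
- by apply/measurable_EFinP; exact: measurable_funX.
by apply: filterS gE => w /= -> .
Qed.

Let int_g : (\int[P]_w (g (X w) ^+ 2)%:E = (sq_dist f)%:E)%E.
Proof. by rewrite /sq_dist int_gap fineK//; exact: integrable_fin_num. Qed.

Lemma integral_sq_dist :
  (\int[P]_w ((f0 (Z w).2 - f (Z w).2) ^+ 2)%:E = (sq_dist f)%:E)%E.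
Proof. by rewrite int_gap int_g. Qed.

Lemma sq_dist_ge0 : 0 <= sq_dist f.
Proof. by rewrite fine_ge0//; apply: integral_ge0 => w _; rewrite lee_fin sqr_ge0. Qed.

Let excessE w : f0 (X w) - f (X w) = g (X w) ->
  excess_loss f (Z w) = g (X w) ^+ 2 + 2 * g (X w) * eps w.
Proof. by move=> <-; rewrite /excess_loss /eps /X; ring. Qed.

Hypothesis varsigma0 : 0 < varsigma.

Section exponential_moments.
Variable t : R.
Hypotheses (t0 : 0 < t).
Hypotheses (tsigma : t * sigma ^+ 2 <= 16^-1) (tC : t * C ^+ 2 <= 48^-1).
Hypothesis tvarsigma : t * C * varsigma <= 16^-1.

Let mloss : measurable_fun setT (fun w => excess_loss f (Z w)).
Proof.
by apply: measurable_funB; apply: measurable_funX; exact: measurable_funB.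
Qed.

Let mapprox : measurable_fun setT (fun w => g (X w) ^+ 2 + 2 * g (X w) * eps w).
Proof.
apply: measurable_funD; first exact: measurable_funX.
by apply: measurable_funM => //; exact: measurable_funM.
Qed.

Lemma integral_expRN_excess_loss_le :
  (\int[P]_w (expR (- (t * excess_loss f (Z w))))%:E <=
   (expR (- (3 / 4 * (t * sq_dist f))))%:E)%E.
Proof.
case: model => _ _ _ mom.
have := integral_expRN_excess_le mX meps varsigma0 t0 eps_center mom tsigma
  tC tvarsigma mg gC int_g.
apply: le_trans; apply/eqW/ae_eq_integral => //.
- apply/measurable_EFinP/measurableT_comp => //; apply: measurableT_comp => //.
  exact: measurable_funM.
- apply/measurable_EFinP/measurableT_comp => //; apply: measurableT_comp => //.
  exact: measurable_funM.
by apply: filterS gE => w /= h _; rewrite excessE.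
Qed.

Lemma integral_expR_excess_loss_le :
  (\int[P]_w (expR (t * excess_loss f (Z w)))%:E <=
   (expR (4 / 3 * (t * sq_dist f)))%:E)%E.
Proof.
case: model => _ _ _ mom.
have := integral_expR_excess_le mX meps varsigma0 t0 eps_center mom tsigma
  tC tvarsigma mg gC int_g.
apply: le_trans; apply/eqW/ae_eq_integral => //.
- by apply/measurable_EFinP/measurableT_comp => //; exact: measurable_funM.
- by apply/measurable_EFinP/measurableT_comp => //; exact: measurable_funM.
by apply: filterS gE => w /= h _; rewrite excessE.
Qed.

End exponential_moments.

Let ieps2 : P.-integrable setT (fun w => (eps w ^+ 2)%:E).
Proof.
case: model => _ _ _ /(_ 2%N isT)[h [ie _ _ _] _].
by move: ie; rewrite /comp; under eq_fun do rewrite real_normK ?num_real//.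
Qed.

Lemma risk_bayesE : risk P Z f0 \is a fin_num.
Proof. by rewrite /risk unlock; exact: integrable_fin_num. Qed.

(** Pythagoras: in the square of [Y - f(X) = eps + g(X)] the cross term has mean
    zero because [eps] is centred given [X]. *)
Lemma risk_excess : (risk P Z f = risk P Z f0 + (sq_dist f)%:E)%E.
Proof.
have i1 : P.-integrable setT (fun w => (2 * g (X w) * eps w)%:E).
  apply: (@integrable_bounded_mul _ _ _ P (fun w => 2 * g (X w)) eps (2 * (2 * C))).
  - exact: measurable_funM.
  - by move=> w; rewrite normrM ger0_norm// ler_wpM2l.
  - by case: eps_center.
have c1 : (\int[P]_w (2 * g (X w) * eps w)%:E = 0)%E.
  apply: (integral_bounded_mul_center mX meps eps_center (h := fun x => 2 * g x)
    (M := 2 * (2 * C))).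
    exact: measurable_funM.
  by move=> x; rewrite normrM ger0_norm// ler_wpM2l.
rewrite /risk unlock -int_g.
transitivity (\int[P]_w ((eps w ^+ 2)%:E + (2 * g (X w) * eps w)%:E + (g (X w) ^+ 2)%:E))%E.
  apply: ae_eq_integral => //.
  - by apply/measurable_EFinP/measurable_funX; exact: measurable_funB.
  - apply: emeasurable_funD; [apply: emeasurable_funD|]; apply/measurable_EFinP.
    + exact: measurable_funX.
    + by apply: measurable_funM => //; exact: measurable_funM.
    + exact: measurable_funX.
  apply: filterS gE => w /= h _; rewrite -!EFinD; congr EFin.
  by rewrite -h /eps /X; ring.
rewrite integralD//; last exact: integrableD.
by rewrite integralD// c1 adde0.
Qed.

End one_predictor.

(** From [(u - v)^2 <= 3/2 u^2 + 3 v^2]. The factor [3/2] is what the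
    moment constants [3/4] and [4/3] allow: [(4/3) (4/3) (3/2) = 8/3]. *)
Lemma sq_dist_perturb (f f' : d.-tuple R -> R) (kappa : R) :
  measurable_fun setT f -> measurable_fun setT f' ->
  (sup_norm f <= C%:E)%E -> (sup_norm f' <= C%:E)%E ->
  (forall x, cube x -> `|f x - f' x| <= kappa) ->
  sq_dist f <= 3 / 2 * sq_dist f' + 3 * kappa ^+ 2.
Proof.
move=> mf mf' fC fC' ff'.
have msq (h : d.-tuple R -> R) : measurable_fun setT h ->
    measurable_fun setT (fun w => ((f0 (X w) - h (X w)) ^+ 2)%:E).
  move=> mh; apply/measurable_EFinP; apply: measurable_funX.
  by apply: measurable_funB; exact: measurableT_comp.
rewrite -lee_fin -(integral_sq_dist mf fC).
have -> : ((3 / 2 * sq_dist f' + 3 * kappa ^+ 2)%:E = \int[P]_w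
    ((3 / 2)%:E * ((f0 (X w) - f' (X w)) ^+ 2)%:E + (3 * kappa ^+ 2)%:E))%E.
  rewrite ge0_integralD//; last 3 first.
  - by move=> w _; rewrite -EFinM lee_fin mulr_ge0 ?sqr_ge0.
  - by apply: emeasurable_funM => //; exact: msq.
  - by move=> w _; rewrite lee_fin mulr_ge0 ?sqr_ge0.
  rewrite ge0_integralZl//; last 2 first.
  - exact: msq.
  - by move=> w _; rewrite lee_fin sqr_ge0.
  rewrite integral_cst// [X in (_ + _ * X)%E]probability_setT mule1.
  by rewrite (integral_sq_dist mf' fC') -EFinM -EFinD.
apply: ae_ge0_le_integral => //.
- by move=> w _; rewrite lee_fin sqr_ge0.
- exact: msq.
- by move=> w _; rewrite -EFinM -EFinD lee_fin addr_ge0// mulr_ge0 ?sqr_ge0.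
- by apply: emeasurable_funD => //; apply: emeasurable_funM => //; exact: msq.
apply: filterS X_cube => w wc _; rewrite -EFinM -EFinD lee_fin.
have := ff' _ wc; rewrite ler_norml => /andP[h1 h2].
set u := f0 (X w) - f' (X w); set v := f (X w) - f' (X w) in h1 h2.
have -> : f0 (X w) - f (X w) = u - v by rewrite /u /v; ring.
have v2 : v ^+ 2 <= kappa ^+ 2 by nra.
have := sqr_ge0 (u + 2 * v); nra.
Qed.
End regression_risk.

(** * Gibbs measures *)

Section eq_integral_measurable.
Import HBNNSimple.

(** The integral is built from simple functions, whose fibres are measurable. This
    allows [gibbs], which is a measure on measurable sets only, to be
    replaced by a genuine measure. *)
Lemma eq_integral_measurable {R : realType} d (T : measurableType d)
    (m1 m2 : set T -> \bar R) (D : set T) (f : T -> \bar R) :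
  (forall A, measurable A -> m1 A = m2 A) ->
  (\int[m1]_(x in D) f x = \int[m2]_(x in D) f x)%E.
Proof.
move=> m12; rewrite /integral.
have E (h : {nnsfun T >-> R}) : sintegral m1 h = sintegral m2 h.
  by apply: eq_fsbigr => x _; rewrite m12.
by congr (ereal_sup _ - ereal_sup _)%E; apply: eq_imagel => h _; rewrite E.
Qed.

Lemma eq_integral_set_function {R : realType} d (T : measurableType d)
    (m : set T -> \bar R) (D : set T) (f g : T -> \bar R) :
  (forall x, D x -> f x = g x) ->
  (\int[m]_(x in D) f x = \int[m]_(x in D) g x)%E.
Proof.
move=> fg; rewrite /integral; have -> // : f \_ D = g \_ D.
by apply/funext => x; rewrite !patchE; case: ifPn => // /set_mem; exact: fg.
Qed.

End eq_integral_measurable.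

Section gibbs.
Local Open Scope ereal_scope.
Context {R : realType} d (T : measurableType d).
Variables (pi : probability T R) (S : set T) (lambda : R) (r : T -> R).
Hypotheses (mS : measurable S) (mr : measurable_fun setT r).
Hypotheses (lambda0 : (0 <= lambda)%R) (r0 : forall x, (0 <= r x)%R).

Let E x := expR (- lambda * r x).
Let N := \int[pi]_(x in S) (E x)%:E.

Let mE : measurable_fun setT E.
Proof. by apply: measurableT_comp => //; exact: measurable_funM. Qed.

Let E1 x : (E x <= 1)%R.
Proof. by rewrite -expR0 ler_expR mulNr oppr_le0 mulr_ge0. Qed.

Let N_fin : N \is a fin_num.
Proof.
rewrite ge0_fin_numE ?integral_ge0//; last by move=> x _; rewrite lee_fin expR_ge0.
apply: (@le_lt_trans _ _ (\int[pi]_(x in S) 1)).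
  apply: ge0_le_integral => //.
  - by move=> x _; rewrite lee_fin expR_ge0.
  - by apply: measurable_funTS; exact/measurable_EFinP.
  - by move=> x _; rewrite lee_fin.
by rewrite integral_cst// mul1e (le_lt_trans (probability_le1 _ _))// ltry.
Qed.

Let N_ge0 : (0 <= fine N)%R.
Proof. by rewrite fine_ge0// integral_ge0// => x _; rewrite lee_fin expR_ge0. Qed.

Let G x := (E x * \1_S x / fine N)%R.

Let mG : measurable_fun setT G.
Proof. by do 2 apply: measurable_funM => //. Qed.

Let G0 x : (0 <= G x)%R.
Proof. by rewrite /G mulr_ge0 ?invr_ge0// mulr_ge0 ?expR_ge0. Qed.

Lemma ge0_integral_gibbs (f : T -> \bar R) :
  measurable_fun setT f -> (forall x, 0 <= f x) ->
  \int[gibbs pi S lambda r]_(x in S) f x =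
  (\int[pi]_(x in S) (f x * (expR (- lambda * r x))%:E)) *
  (fine (\int[pi]_(x in S) (expR (- lambda * r x))%:E))^-1%:E.
Proof.
move=> mf f0.
rewrite (@eq_integral_measurable _ _ _ _ (weighted pi mG G0)); last first.
  move=> A mA; rewrite /gibbs integral_mkcondl -ge0_integralZr//; last 3 first.
  - apply: measurable_funTS; apply/(measurable_restrictT _ _).1 => //.
    by apply: measurable_funTS; exact/measurable_EFinP.
  - by move=> x _; apply: erestrict_ge0 => y _; rewrite lee_fin expR_ge0.
  - by rewrite lee_fin invr_ge0.
  apply: eq_integral => x _; rewrite patchE /G indicE.
  by case: ifP => _; rewrite ?mulr1 ?mulr0 ?mul0r ?mul0e// -EFinM.
rewrite integral_mkcond ge0_integral_weighted//; last 2 first.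
- by apply/(measurable_restrictT _ _).1 => //; exact: measurable_funTS.
- exact: erestrict_ge0.
rewrite -ge0_integralZr//; last 3 first.
- apply: measurable_funTS; apply: emeasurable_funM => //; exact/measurable_EFinP.
- by move=> x _; rewrite mule_ge0// lee_fin expR_ge0.
- by rewrite lee_fin invr_ge0.
rewrite [RHS]integral_mkcond; apply: eq_integral => x _.
rewrite !patchE /G indicE; case: ifP => _; last by rewrite mul0e.
by rewrite mulr1 EFinM muleA.
Qed.

Let N_gt0 : 0 < pi S -> (0 < fine N)%R.
Proof.
move=> piS; rewrite lt_neqAle N_ge0 andbT eq_sym; apply/negP => /eqP N0.
have : \int[pi]_(x in S) `|(E x)%:E| = 0.
  under eq_integral do rewrite gee0_abs ?lee_fin ?expR_ge0//.
  by rewrite -/N -(fineK N_fin) N0.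
have mES : measurable_fun S (fun x => (E x)%:E).
  by apply: measurable_funTS; exact/measurable_EFinP.
move/(ae_eq_integral_abs pi mS mES) => [A [mA A0 EA]].
have : pi S <= 0.
  rewrite -A0; apply: le_measure; rewrite ?inE// => x Sx; apply: EA => /= h.
  by have [] := h Sx; apply/eqP; rewrite gt_eqF// expR_gt0.
by rewrite leNgt piS.
Qed.

(** The Gibbs law has total mass 1. *)
Lemma integral_gibbs_affine (s : T -> R) (a k : R) : 0 < pi S ->
  measurable_fun setT s -> (forall x, (0 <= s x)%R) -> (0 <= a)%R -> (0 <= k)%R ->
  \int[gibbs pi S lambda r]_(x in S) (a + k * s x)%:E =
  a%:E + k%:E * \int[gibbs pi S lambda r]_(x in S) (s x)%:E.
Proof.
move=> piS ms s0 a0 k0.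
have mks : measurable_fun setT (fun x => a + k * s x)%R.
  by apply: measurable_funD => //; exact: measurable_funM.
rewrite !ge0_integral_gibbs//; last 3 first.
- exact/measurable_EFinP.
- exact/measurable_EFinP.
- by move=> x; rewrite lee_fin addr_ge0// mulr_ge0.
have mES : measurable_fun S (fun x => (E x)%:E).
  by apply: measurable_funTS; exact/measurable_EFinP.
have msE : measurable_fun S (fun x => (s x)%:E * (E x)%:E).
  by apply: emeasurable_funM => //; apply: measurable_funTS; exact/measurable_EFinP.
have sE0 x : 0 <= (s x)%:E * (E x)%:E.
  by rewrite -EFinM lee_fin mulr_ge0// expR_ge0.
have E0 x : 0 <= (E x)%:E by rewrite lee_fin expR_ge0.
rewrite (eq_integral (fun x => a%:E * (E x)%:E + k%:E * ((s x)%:E * (E x)%:E))); last first.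
  by move=> x _; rewrite -!EFinM -EFinD; congr EFin; rewrite /E; ring.
rewrite ge0_integralD//; last 4 first.
- by move=> x _; rewrite mule_ge0.
- exact: emeasurable_funM.
- by move=> x _; rewrite mule_ge0.
- exact: emeasurable_funM.
rewrite ge0_integralZl// ge0_integralZl// -/N.
rewrite ge0_muleDl//; last 2 first.
- by rewrite mule_ge0 ?lee_fin// integral_ge0.
- by rewrite mule_ge0 ?lee_fin// integral_ge0.
have -> : a%:E * N * (fine N)^-1%:E = a%:E.
  by rewrite -{1}(fineK N_fin) -!EFinM mulfK// gt_eqF// N_gt0.
by rewrite muleA.
Qed.

Variables (e : T -> R) (B : set T) (c : R).
Hypotheses (me : measurable_fun setT e) (e0 : forall x, (0 <= e x)%R).
Hypotheses (mB : measurable B) (BS : B `<=` S) (piB : 0 < pi B).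

Let fA x := expR (e x - (lambda * r x - c)).
Let fW x := expR (lambda * r x - c).

Let mfW : measurable_fun setT fW.
Proof.
by apply: measurableT_comp => //; apply: measurable_funB => //; exact: measurable_funM.
Qed.

Let b := fine (pi B).

Let b0 : (0 < b)%R.
Proof. by rewrite fine_gt0// piB (le_lt_trans (probability_le1 _ _)) ?ltry. Qed.

Let piE : pi B = b%:E.
Proof. by rewrite fineK// fin_num_measure. Qed.

(** The Cauchy--Schwarz inequality: the square of [pi B] is at most the product of
    the integrals over [B] of [exp (- l)] and [exp l], where
    [l = lambda r - c]. It is obtained by integrating
    [2 y <= exp (- l) + y^2 exp l] with the best choice [y = pi(B) / V]; the
    integral of [exp (- l)] only grows when extended to [S]. *)
Lemma gibbs_normalization_ge (V : R) : (0 < V)%R ->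
  \int[pi]_(x in B) (expR (lambda * r x - c))%:E <= V%:E ->
  (b ^+ 2 / V <= expR c * fine N)%R.
Proof.
move=> V0 WV.
pose y := (b / V)%R; have y0 : (0 < y)%R by rewrite divr_gt0.
have key : (y *+ 2)%:E * pi B <= (expR c * fine N)%:E + (y ^+ 2 * V)%:E.
  apply: (@le_trans _ _ (\int[pi]_(x in B) ((expR c * E x)%:E + (y ^+ 2 * fW x)%:E))).
    rewrite -integral_cst//; apply: ge0_le_integral => //.
    - by move=> x _; rewrite lee_fin mulrn_wge0// ltW.
    - apply: measurable_funTS; apply: emeasurable_funD; apply/measurable_EFinP;
        exact: measurable_funM.
    move=> x _; rewrite -EFinD lee_fin.
    have -> : (expR c * E x = (fW x)^-1)%R.
      by rewrite /E /fW -expRN -expRD; congr expR; ring.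
    have W0 : (0 < fW x)%R by exact: expR_gt0.
    rewrite -subr_ge0 (_ : _ - _ = (y * fW x - 1) ^+ 2 / fW x)%R; last first.
      by field; rewrite gt_eqF.
    by rewrite divr_ge0 ?sqr_ge0// ltW.
  rewrite ge0_integralD//; last 4 first.
  - by move=> x _; rewrite lee_fin mulr_ge0 ?expR_ge0.
  - apply: measurable_funTS; apply/measurable_EFinP; exact: measurable_funM.
  - by move=> x _; rewrite lee_fin mulr_ge0 ?expR_ge0 ?sqr_ge0.
  - apply: measurable_funTS; apply/measurable_EFinP; exact: measurable_funM.
  apply: leeD.
    under eq_integral do rewrite EFinM.
    rewrite ge0_integralZl ?lee_fin ?expR_ge0//; last 2 first.
    - by apply: measurable_funTS; exact/measurable_EFinP.
    - by move=> x _; rewrite lee_fin expR_ge0.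
    rewrite EFinM lee_pmul2l ?lte_fin ?expR_gt0// fineK//.
    apply: ge0_subset_integral => //.
      by apply: measurable_funTS; exact/measurable_EFinP.
    by move=> x _; rewrite lee_fin expR_ge0.
  under eq_integral do rewrite EFinM.
  rewrite ge0_integralZl ?lee_fin ?sqr_ge0//; last 2 first.
  - by apply: measurable_funTS; exact/measurable_EFinP.
  - by move=> x _; rewrite lee_fin expR_ge0.
  by rewrite [leRHS]EFinM lee_wpmul2l// lee_fin sqr_ge0.
move: key; rewrite piE -EFinM -EFinD lee_fin.
have -> : (b ^+ 2 / V = y *+ 2 * b - y ^+ 2 * V)%R by rewrite /y; field; rewrite gt_eqF.
lra.
Qed.

(** With [s = - ln (al * exp c * N)], [N] being the normalization, the tangent
    inequality [e <= exp (e - s) + s - 1] integrates to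
    [al A + s - 1], since [exp (- s)] times the Gibbs density is
    [al exp (- l)]. The previous lemma bounds [s], and a second tangent
    inequality, [ln (be V) <= be V - 1], makes the bound affine in [V] so that
    expectations can be taken. *)
Lemma gibbs_integral_le (al be : R) : (0 < al)%R -> (0 < be)%R ->
  \int[gibbs pi S lambda r]_(x in S) (e x)%:E <=
  al%:E * \int[pi]_(x in S) (expR (e x - (lambda * r x - c)))%:E +
  be%:E * \int[pi]_(x in B) (expR (lambda * r x - c))%:E +
  (- 2 - ln al - ln be - 2 * ln b)%:E.
Proof.
move=> al0 be0; rewrite ge0_integral_gibbs//; last exact/measurable_EFinP.
have mfA : measurable_fun setT fA.
  apply: measurableT_comp => //; apply: measurable_funB => //.
  by apply: measurable_funB => //; exact: measurable_funM.
set A := \int[pi]_(x in S) (expR (e x - (lambda * r x - c)))%:E.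
have A0 : 0 <= A by apply: integral_ge0 => x _; rewrite lee_fin expR_ge0.
have W0 : 0 <= \int[pi]_(x in B) (fW x)%:E.
  by apply: integral_ge0 => x _; rewrite lee_fin expR_ge0.
have := gibbs_normalization_ge.
move: W0; rewrite -/fW; case: (\int[pi]_(x in B) _) => [V|_ _|//]; last first.
  rewrite gt0_muley ?lte_fin// addey; first by rewrite addye ?leey.
  by rewrite -ltNye (lt_le_trans (ltNyr 0))// mule_ge0// lee_fin ltW.
rewrite lee_fin => V0 hV.
have {V0} V0 : (0 < V)%R.
  rewrite lt_neqAle V0 andbT; apply/eqP => V00.
  have p0 : (0 < expR c * fine N + 1)%R by rewrite ltr_wpDl// mulr_ge0 ?expR_ge0.
  have := hV (b ^+ 2 / (expR c * fine N + 1))%R.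
  rewrite divr_gt0 ?exprn_gt0// -V00 lee_fin => /(_ isT).
  rewrite ltW ?divr_gt0 ?exprn_gt0// => /(_ isT).
  rewrite invf_div mulrC divfK ?gt_eqF ?exprn_gt0//; lra.
have {}hV := hV V V0 (lexx _).
have cN0 : (0 < expR c * fine N)%R by rewrite (lt_le_trans _ hV)// divr_gt0 ?exprn_gt0.
have N0 : (0 < fine N)%R by rewrite -(pmulr_rgt0 _ (expR_gt0 c)).
pose k := (- ln (al * (expR c * fine N)) - 1)%R.
have kE : (k <= be * V + (- 2 - ln al - ln be - 2 * ln b))%R.
  rewrite /k lnM ?posrE//.
  have l1 : (ln (b ^+ 2 / V) <= ln (expR c * fine N))%R.
    by rewrite ler_ln ?posrE// divr_gt0 ?exprn_gt0.
  have l2 : (ln (be * V) <= be * V - 1)%R.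
    have := @le_ln1Dx R (be * V - 1); rewrite addrCA subrr addr0; apply.
    have := mulr_gt0 be0 V0; lra.
  move: l1 l2; rewrite ln_div ?posrE ?exprn_gt0// lnXn// [ln (be * V)]lnM ?posrE// mulr_natl; lra.
suff : \int[pi]_(x in S) ((e x)%:E * (E x)%:E) * (fine N)^-1%:E <=
    al%:E * A + k%:E.
  by move=> /le_trans; apply; rewrite -addeA leeD2l// -EFinM -EFinD lee_fin.
(* The constant [k] may be negative; its parts keep the integrands nonnegative. *)
pose kp := maxr k 0%R; pose kn := maxr (- k)%R 0%R.
have kpn : k = (kp - kn)%R.
  rewrite /kp /kn; have [h|] := boolP (0 <= k)%R.
    by rewrite max_l// max_r ?subr0// oppr_le0.
  rewrite -ltNge => h.
  by rewrite max_r ?ltW// max_l ?sub0r ?opprK// oppr_ge0 ltW.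
have kp0 : (0 <= kp)%R by rewrite le_max lexx orbT.
have kn0 : (0 <= kn)%R by rewrite le_max lexx orbT.
have mES : measurable_fun S (fun x => (E x)%:E).
  by apply: measurable_funTS; exact/measurable_EFinP.
have qE a : (0 <= a)%R -> \int[pi]_(x in S) (a * (E x / fine N))%:E = a%:E.
  move=> a0; under eq_integral do rewrite mulrCA mulrC EFinM.
  rewrite ge0_integralZl ?lee_fin ?divr_ge0//; last first.
    by move=> x _; rewrite lee_fin expR_ge0.
  by rewrite -/N -{2}(fineK N_fin) -EFinM divfK ?gt_eqF.
have main : \int[pi]_(x in S) ((e x)%:E * (E x)%:E) * (fine N)^-1%:E + kn%:E <=
    al%:E * A + kp%:E.
  rewrite -(qE kn kn0) -(qE kp kp0).
  have mq a : measurable_fun S (fun x => (a * (E x / fine N))%:E).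
    apply: measurable_funTS; apply/measurable_EFinP.
    by apply: measurable_funM => //; exact: measurable_funM.
  have q0 a x : (0 <= a)%R -> 0 <= (a * (E x / fine N))%:E.
    by move=> a0; rewrite lee_fin mulr_ge0// divr_ge0// expR_ge0.
  have mfAS : measurable_fun S (fun x => (fA x)%:E).
    by apply: measurable_funTS; exact/measurable_EFinP.
  have meES : measurable_fun S (fun x => (e x)%:E * (E x)%:E).
    by apply: emeasurable_funM => //; apply: measurable_funTS; exact/measurable_EFinP.
  rewrite -ge0_integralZr ?lee_fin ?invr_ge0//; last first.
    by move=> x _; rewrite -EFinM lee_fin mulr_ge0// expR_ge0.
  rewrite -ge0_integralZl ?lee_fin ?(ltW al0)//.
  rewrite -ge0_integralD//; last 3 first.
  - by move=> x _; rewrite -!EFinM lee_fin mulr_ge0 ?invr_ge0// mulr_ge0// expR_ge0.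
  - by apply: emeasurable_funM.
  - by move=> x _; exact: q0.
  rewrite -ge0_integralD//; last 3 first.
  - by move=> x _; rewrite -EFinM lee_fin mulr_ge0 ?expR_ge0// ltW.
  - by apply: emeasurable_funM.
  - by move=> x _; exact: q0.
  apply: ge0_le_integral => //.
  - move=> x _; rewrite adde_ge0 ?q0// -!EFinM lee_fin.
    by rewrite mulr_ge0 ?invr_ge0// mulr_ge0// expR_ge0.
  - by apply: emeasurable_funD => //; apply: emeasurable_funM.
  - by apply: emeasurable_funD => //; apply: emeasurable_funM.
  move=> x _; rewrite -!EFinM -!EFinD lee_fin.
  pose s := (- ln (al * (expR c * fine N)))%R.
  have tang : (e x <= expR (e x - s) + k)%R.
    by have := expR_ge1Dx (e x - s); rewrite /k -/s; lra.
  have q1 : (0 <= E x / fine N)%R by rewrite divr_ge0// expR_ge0.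
  have := ler_wpM2r q1 tang; rewrite mulrDl.
  have -> : (expR (e x - s) * (E x / fine N) = al * fA x)%R.
    rewrite /s opprK expRD lnK ?posrE ?mulr_gt0 ?expR_gt0//.
    have -> : fA x = (expR (e x) * E x * expR c)%R.
      by rewrite /fA /E -!expRD; congr expR; ring.
    by field; rewrite gt_eqF.
  rewrite kpn mulrBl -/(fA x) -mulrA; lra.
move: main; rewrite -leeBrDr// => /le_trans; apply.
by rewrite kpn EFinB addeA.
Qed.

End gibbs.

(** * PAC-Bayes inequalities *)

Section parametric_integral.
Local Open Scope ereal_scope.
Context {R : realType} d d' (Omega : measurableType d) (T : measurableType d').
Variables (P : probability Omega R) (pi : probability T R).
Variables (F : Omega -> T -> R) (S : set T).
Hypotheses (mS : measurable S).
Hypotheses (mF : measurable_fun setT (fun p : Omega * T => F p.1 p.2)).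
Hypothesis F0 : forall w x, (0 <= F w x)%R.

Let f (p : Omega * T) : \bar R := (F p.1 p.2 * \1_S p.2)%:E.

Let mf : measurable_fun setT f.
Proof.
apply/measurable_EFinP; apply: measurable_funM => //.
exact: measurableT_comp.
Qed.

Let f0 p : 0 <= f p.
Proof. by rewrite lee_fin mulr_ge0. Qed.

Let fE w : \int[pi]_(x in S) (F w x)%:E = \int[pi]_x f (w, x).
Proof.
rewrite integral_mkcond; apply: eq_integral => x _; rewrite patchE /f /= indicE.
by case: ifP => _; rewrite ?mulr1 ?mulr0.
Qed.

Lemma measurable_parametric_integral :
  measurable_fun setT (fun w => \int[pi]_(x in S) (F w x)%:E).
Proof. by under eq_fun do rewrite fE; exact: measurable_fun_fubini_tonelli_F. Qed.

Lemma exchange_parametric_integral :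
  \int[P]_w \int[pi]_(x in S) (F w x)%:E = \int[pi]_(x in S) \int[P]_w (F w x)%:E.
Proof.
under eq_integral do rewrite fE; rewrite (fubini_tonelli f)//.
rewrite [RHS]integral_mkcond; apply: eq_integral => x _.
rewrite patchE /f /= indicE; case: ifP => _.
  by under eq_integral do rewrite mulr1.
by under eq_integral do rewrite mulr0; rewrite integral0.
Qed.

End parametric_integral.

Section pac_bayes.
Local Open Scope ereal_scope.
Context {R : realType} d d' (Omega : measurableType d) (T : measurableType d').
Variables (P : probability Omega R) (pi : probability T R).
Variables (S B : set T) (lambda : R) (r : Omega -> T -> R) (c : Omega -> R).
Variables (e : T -> R) (w0 : R).
Hypotheses (mS : measurable S) (mB : measurable B) (BS : B `<=` S).
Hypotheses (piB : 0 < pi B) (lambda0 : (0 <= lambda)%R).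
Hypothesis mr : measurable_fun setT (fun p : Omega * T => r p.1 p.2).
Hypotheses (r0 : forall w x, (0 <= r w x)%R) (mc : measurable_fun setT c).
Hypotheses (me : measurable_fun setT e) (e0 : forall x, (0 <= e x)%R).
Hypothesis w01 : (1 <= w0)%R.
Hypothesis moment_S : forall x, S x ->
  \int[P]_w (expR (e x - (lambda * r w x - c w)))%:E <= 1.
Hypothesis moment_B : forall x, B x ->
  \int[P]_w (expR (lambda * r w x - c w))%:E <= w0%:E.

Let post w := \int[gibbs pi S lambda (r w)]_(x in S) (e x)%:E.
Let b := fine (pi B).

Let b0 : (0 < b)%R.
Proof. by rewrite fine_gt0// piB (le_lt_trans (probability_le1 _ _)) ?ltry. Qed.

Let piE : pi B = b%:E.
Proof. by rewrite fineK// fin_num_measure. Qed.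

Let mrw w : measurable_fun setT (r w).
Proof. exact: (measurableT_comp mr (pair1_measurable w)). Qed.

Let mE : measurable_fun setT (fun p : Omega * T => expR (- lambda * r p.1 p.2)).
Proof. by apply: measurableT_comp => //; exact: measurable_funM. Qed.

Let postE w : post w = (\int[pi]_(x in S) (e x * expR (- lambda * r w x))%:E) *
  (fine (\int[pi]_(x in S) (expR (- lambda * r w x))%:E))^-1%:E.
Proof.
by rewrite /post ge0_integral_gibbs//; exact/measurable_EFinP.
Qed.

Lemma measurable_gibbs_integral : measurable_fun setT post.
Proof.
rewrite (_ : post = fun w =>
    (\int[pi]_(x in S) (e x * expR (- lambda * r w x))%:E) *
    (fine (\int[pi]_(x in S) (expR (- lambda * r w x))%:E))^-1%:E); last first.
  by apply/funext => w; exact: postE.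
apply: emeasurable_funM.
  apply: (@measurable_parametric_integral _ _ _ _ _ pi
    (fun w x => e x * expR (- lambda * r w x))%R) => //.
  - by apply: measurable_funM => //; exact: measurableT_comp.
  - by move=> w x; rewrite mulr_ge0// expR_ge0.
apply/measurable_EFinP.
(* The inverse of a nonnegative number is a real power, hence measurable. *)
under eq_fun => w.
  rewrite -powR_inv1; last first.
    by rewrite fine_ge0// integral_ge0// => x _; rewrite lee_fin expR_ge0.
  over.
apply: (measurableT_comp (measurable_powR _)).
apply: measurableT_comp; first exact: fine_measurable.
apply: (@measurable_parametric_integral _ _ _ _ _ pi
  (fun w x => expR (- lambda * r w x))) => // w x; exact: expR_ge0.
Qed.

Let fA w x := expR (e x - (lambda * r w x - c w)).
Let fW w x := expR (lambda * r w x - c w).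
Let A w := \int[pi]_(x in S) (fA w x)%:E.
Let W w := \int[pi]_(x in B) (fW w x)%:E.
Let N w := A w + ((w0 * b)^-1)%:E * W w.

Let mfW : measurable_fun setT (fun p : Omega * T => fW p.1 p.2).
Proof.
apply: measurableT_comp => //; apply: measurable_funB; first exact: measurable_funM.
exact: measurableT_comp.
Qed.

Let mfA : measurable_fun setT (fun p : Omega * T => fA p.1 p.2).
Proof.
apply: measurableT_comp => //; apply: measurable_funB; first exact: measurableT_comp.
apply: measurable_funB; first exact: measurable_funM.
exact: measurableT_comp.
Qed.

Let A0 w : 0 <= A w.
Proof. by apply: integral_ge0 => x _; rewrite lee_fin expR_ge0. Qed.

Let W0 w : 0 <= W w.
Proof. by apply: integral_ge0 => x _; rewrite lee_fin expR_ge0. Qed.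

Let wb0 : (0 < w0 * b)%R.
Proof. by rewrite mulr_gt0// (lt_le_trans ltr01). Qed.

Let N0 w : 0 <= N w.
Proof. by rewrite adde_ge0// mule_ge0// lee_fin invr_ge0 ltW. Qed.

Let mA : measurable_fun setT A.
Proof. by apply: measurable_parametric_integral => // w x; exact: expR_ge0. Qed.

Let mW : measurable_fun setT W.
Proof. by apply: measurable_parametric_integral => // w x; exact: expR_ge0. Qed.

Let mN : measurable_fun setT N.
Proof. by apply: emeasurable_funD => //; exact: emeasurable_funM. Qed.

Let EN : \int[P]_w N w <= 2%:E.
Proof.
rewrite ge0_integralD//; last 2 first.
- by move=> w _; rewrite mule_ge0// lee_fin invr_ge0 ltW.
- exact: emeasurable_funM.
rewrite (_ : 2%:E = 1 + 1)//; apply: leeD.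
  rewrite exchange_parametric_integral//; last by move=> w x; exact: expR_ge0.
  apply: (@le_trans _ _ (\int[pi]_(x in S) 1)).
    apply: ge0_le_integral => //.
    - by move=> x _; apply: integral_ge0 => w _; rewrite lee_fin expR_ge0.
    - apply: measurable_funTS.
      apply: (measurable_fun_fubini_tonelli_G (fun p : Omega * T => (fA p.1 p.2)%:E)).
        exact/measurable_EFinP.
      by move=> p; rewrite lee_fin expR_ge0.
  by rewrite integral_cst// mul1e probability_le1.
rewrite ge0_integralZl//; last by rewrite lee_fin invr_ge0 ltW.
rewrite exchange_parametric_integral//; last by move=> w x; exact: expR_ge0.
apply: (@le_trans _ _ ((w0 * b)^-1%:E * \int[pi]_(x in B) w0%:E)).
  apply: lee_wpmul2l; first by rewrite lee_fin invr_ge0 ltW.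
  apply: ge0_le_integral => //.
  - by move=> x _; apply: integral_ge0 => w _; rewrite lee_fin expR_ge0.
  - apply: measurable_funTS.
    apply: (measurable_fun_fubini_tonelli_G (fun p : Omega * T => (fW p.1 p.2)%:E)).
      exact/measurable_EFinP.
    by move=> p; rewrite lee_fin expR_ge0.
by rewrite integral_cst// [X in _ * (_ * X)]piE -!EFinM mulVf ?gt_eqF.
Qed.

Let K := (ln w0 - ln b)%R.

Let K0 : (0 <= K)%R.
Proof.
have b1 : (b <= 1)%R by rewrite -lee_fin -piE probability_le1.
by have := ln_ge0 w01; have := ln_le0 b1; rewrite /K; lra.
Qed.

Let post_le (delta : R) w : (0 < delta)%R ->
  post w <= delta%:E * N w + (- 2 - 2 * ln delta + K)%:E.
Proof.
move=> d0.
have db0 : (0 < delta / (w0 * b))%R by rewrite divr_gt0.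
have := gibbs_integral_le mS (mrw w) lambda0 (r0 w) (c w) me e0 mB BS piB d0 db0.
move=> /le_trans; apply.
rewrite /N [in leRHS]ge0_muleDr//; last by rewrite mule_ge0// lee_fin invr_ge0 ltW.
rewrite muleA -EFinM; apply: leeD => //; rewrite lee_fin -/b.
have w00 : (0 < w0)%R by rewrite (lt_le_trans ltr01).
rewrite ln_div ?posrE// lnM ?posrE// /K; lra.
Qed.

(** Both [A] and [W / (w0 pi(B))] have mean at most 1, by exchanging the two
    integrals; this is the case [delta = 1] of [post_le]. *)
Lemma gibbs_integral_expectation_le :
  \int[P]_w \int[gibbs pi S lambda (r w)]_(x in S) (e x)%:E <=
  (ln w0 - ln (fine (pi B)))%:E.
Proof.
have post0 w : 0 <= post w.
  rewrite postE mule_ge0//; last by rewrite lee_fin invr_ge0 fine_ge0// integral_ge0//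
    => x _; rewrite lee_fin expR_ge0.
  by apply: integral_ge0 => x _; rewrite lee_fin mulr_ge0// expR_ge0.
have mp := measurable_gibbs_integral.
have : \int[P]_w (post w + 2%:E) <= \int[P]_w (N w + K%:E).
  apply: ge0_le_integral => //.
  - by move=> w _; rewrite adde_ge0// lee_fin.
  - by apply: emeasurable_funD.
  - by apply: emeasurable_funD.
  move=> w _; have := @post_le 1 w ltr01; rewrite ln1 mul1e mulr0 subr0 => h.
  apply: (le_trans (leeD2r 2%:E h)); rewrite -addeA -EFinD leeD2l// lee_fin; lra.
have intD (f : Omega -> \bar R) (a : R) : (0 <= a)%R -> measurable_fun setT f ->
    (forall w, 0 <= f w) -> \int[P]_w (f w + a%:E) = \int[P]_w f w + a%:E.
  move=> a0 mf f0; rewrite ge0_integralD//; congr (_ + _).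
  by rewrite integral_cst// [X in (_ * X)]probability_setT mule1.
rewrite (intD post 2%R _ mp post0)// (intD N K K0 mN N0) => h.
have {}h := le_trans h (leeD2r K%:E EN).
by move: h; rewrite addeC leeD2lE.
Qed.

(** By Markov's inequality [N < 2 / delta] outside an event of probability
    [delta], and there the term [delta * N] of [post_le] is offset by the
    constant [- 2]. *)
Lemma gibbs_integral_deviation_le (delta : R) : (0 < delta)%R ->
  (1 - delta)%:E <=
  P [set w | \int[gibbs pi S lambda (r w)]_(x in S) (e x)%:E <=
    (ln w0 - ln (fine (pi B)) + 2 * ln delta^-1)%:E].
Proof.
move=> d0; have mp := measurable_gibbs_integral.
set V := [set w | _].
have mV : measurable V.
  rewrite (_ : V = setT `&` V); last by rewrite setTI.
  exact: emeasurable_fun_infty_c.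
have mNd : measurable [set w | (2 / delta)%:E <= N w].
  rewrite (_ : [set w | _] = setT `&` [set w | (2 / delta)%:E <= N w]); last by rewrite setTI.
  exact: emeasurable_fun_c_infty.
have PN : P [set w | (2 / delta)%:E <= N w] <= delta%:E.
  have := @le_integral_abse _ _ _ P setT measurableT N (2 / delta)%R mN.
  rewrite setTI => /(_ (divr_gt0 _ d0)).
  have -> : [set x | (2 / delta)%:E <= `|N x|] = [set w | (2 / delta)%:E <= N w].
    by apply/seteqP; split => w /=; rewrite gee0_abs.
  under eq_integral do rewrite gee0_abs//.
  move=> h; have {}h := le_trans (h (ltr0Sn R 1)) EN.
  have p2 : (0 < 2 / delta)%R by rewrite divr_gt0.
  rewrite -(@lee_pmul2l _ (2 / delta)%:E) ?lte_fin//.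
  by rewrite -EFinM divfK ?gt_eqF.
have VC : ~` V `<=` [set w | (2 / delta)%:E <= N w].
  move=> w /=; apply: contra_notP => /negP; rewrite -ltNge => h.
  rewrite /V /=; apply: (le_trans (post_le w d0)).
  have Nfin : N w \is a fin_num by rewrite ge0_fin_numE// (lt_trans h)// ltry.
  move: h; rewrite -(fineK Nfin) lte_fin ltr_pdivlMr// => h.
  rewrite -EFinM -EFinD lee_fin lnV ?posrE// /K mulrN; lra.
have mVC : measurable (~` V) by exact: measurableC.
have PVC : P (~` V) <= delta%:E.
  by apply: le_trans PN; apply: le_measure => //; rewrite inE.
have -> : V = ~` ~` V by rewrite setCK.
rewrite [leRHS]probability_setC// EFinB leeB//.
Qed.

End pac_bayes.

(** * Networks: measurability and dependence on the parameter *)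

Section network.
Context {R : realType} (phi : R -> R).
Hypothesis lip : 1.-lipschitz phi.

Lemma lipschitz1P x y : `|phi x - phi y| <= `|x - y|.
Proof. by have := lip (x := (x, y)); rewrite /= mul1r; apply. Qed.

Lemma measurable_lipschitz1 : measurable_fun setT phi.
Proof.
apply: continuous_measurable_fun => x; apply/cvgrPdist_le => e e0.
near=> y; apply: le_trans (lipschitz1P _ _) _.
near: y; exact: (cvgr_dist_le (@id R) x).
Unshelve. all: by end_near. Qed.

Lemma layerE m n (a : 'I_m * option 'I_n -> R) (h : 'cV[R]_n) i j :
  layer phi a h i j = phi (\sum_k a (i, Some k) * h k ord0 + a (i, None)).
Proof.
rewrite !mxE ord1; congr (phi (_ + _)).
by apply: eq_bigr => k _; rewrite mxE.
Qed.

Lemma networkE d L D (theta : parameter d L D) x :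
  network phi theta x =
  layer phi (fun p => coef theta (inr p))
   (foldl (fun h l => layer phi (fun p => coef theta (inl (inr (l, p)))) h)
     (layer phi (fun p => coef theta (inl (inl p))) (\col_i tnth x i))
     (enum 'I_L.-2)) ord0 ord0.
Proof. by []. Qed.

Section measurability.
Context du (U : measurableType du).

Lemma measurable_layer m n (a : U -> 'I_m * option 'I_n -> R) (h : U -> 'cV[R]_n) :
  (forall p, measurable_fun setT (a ^~ p)) ->
  (forall k, measurable_fun setT (fun u => h u k ord0)) ->
  forall i, measurable_fun setT (fun u => layer phi (a u) (h u) i ord0).
Proof.
move=> ma mh i; under eq_fun do rewrite layerE.
apply: measurableT_comp; first exact: measurable_lipschitz1.
apply: measurable_funD => //; apply: measurable_sum => k.
exact: measurable_funM.
Qed.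

Lemma measurable_network d L D (theta : U -> parameter d L D) (x : U -> d.-tuple R) :
  measurable_fun setT (theta : U -> #|coef_index d L D|.-tuple R) ->
  measurable_fun setT x ->
  measurable_fun setT (fun u => network phi (theta u) (x u)).
Proof.
move=> mtheta mx.
have mcoef c : measurable_fun setT (fun u => coef (theta u) c).
  exact: (measurableT_comp (measurable_tnth (enum_rank c)) mtheta).
have mfold s (h : U -> 'cV[R]_D) :
    (forall k, measurable_fun setT (fun u => h u k ord0)) ->
    forall k, measurable_fun setT (fun u =>
      foldl (fun h l => layer phi (fun p => coef (theta u) (inl (inr (l, p)))) h)
        (h u) s k ord0).
  elim: s h => [//|l s IHs] h mh; apply: (IHs (fun u => layer phi _ (h u))).
  exact: measurable_layer.
under eq_fun do rewrite networkE; apply: measurable_layer => // k.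
apply: (mfold _ (fun u => layer phi _ (\col_i tnth (x u) i))) => j.
apply: measurable_layer => // i; under eq_fun do rewrite mxE.
exact: (measurableT_comp (measurable_tnth i) mx).
Qed.

End measurability.

Hypothesis phi_le : forall x, `|phi x| <= `|x|.

Lemma layer_bound m n (a : 'I_m * option 'I_n -> R) (h : 'cV[R]_n) (B M : R) :
  1 <= M -> (forall p, `|a p| <= B) -> (forall k, `|h k ord0| <= M) ->
  forall i, `|layer phi a h i ord0| <= n.+1%:R * B * M.
Proof.
move=> M1 aB hM i; rewrite layerE (le_trans (phi_le _))//.
have B0 : 0 <= B := le_trans (normr_ge0 _) (aB (i, None)).
rewrite (le_trans (ler_normD _ _))// -natr1 !mulrDl mul1r lerD//; last first.
  by rewrite (le_trans (aB _))// ler_peMr.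
rewrite (le_trans (ler_norm_sum _ _ _))//.
apply: (@le_trans _ _ (\sum_(k < n) B * M)).
  by apply: ler_sum => k _; rewrite normrM ler_pM.
by rewrite sumr_const card_ord -mulrA mulr_natl.
Qed.

Lemma layer_diff m n (a a' : 'I_m * option 'I_n -> R) (h h' : 'cV[R]_n)
    (B M eta del : R) :
  1 <= M -> (forall p, `|a' p| <= B) -> (forall p, `|a p - a' p| <= eta) ->
  (forall k, `|h k ord0| <= M) -> (forall k, `|h k ord0 - h' k ord0| <= del) ->
  0 <= del ->
  forall i, `|layer phi a h i ord0 - layer phi a' h' i ord0| <=
    n.+1%:R * eta * M + n.+1%:R * B * del.
Proof.
move=> M1 aB aa hM hh del0 i; rewrite !layerE (le_trans (lipschitz1P _ _))//.
have eta0 : 0 <= eta := le_trans (normr_ge0 _) (aa (i, None)).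
have B0 : 0 <= B := le_trans (normr_ge0 _) (aB (i, None)).
rewrite opprD addrACA -sumrB (le_trans (ler_normD _ _))//.
apply: (@le_trans _ _ (\sum_(k < n) (eta * M + B * del) + eta)).
  apply: lerD => //; rewrite (le_trans (ler_norm_sum _ _ _))//.
  apply: ler_sum => k _.
  have -> : a (i, Some k) * h k ord0 - a' (i, Some k) * h' k ord0 =
    (a (i, Some k) - a' (i, Some k)) * h k ord0 + a' (i, Some k) * (h k ord0 - h' k ord0).
    by ring.
  by rewrite (le_trans (ler_normD _ _))// !normrM lerD// ler_pM.
rewrite sumr_const card_ord -mulr_natl -natr1.
have n0 : 0 <= n%:R :> R by [].
have eM : eta <= eta * M by rewrite ler_peMr.
have Bd : 0 <= B * del by rewrite mulr_ge0.
lra.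
Qed.

(** With [G = (D + 1) B], after [k] layers the activations are at most [G^k] and
    those of the two networks differ by at most [k eta G^k]: one more layer
    multiplies the accumulated difference by [G], and its own coefficients
    contribute [(D + 1) eta G^k]. *)
Lemma network_lipschitz d L D (theta theta' : parameter d L D) (x : d.-tuple R)
    (B eta : R) :
  (2 <= L)%N -> (d <= D)%N -> 1 <= B -> 0 <= eta -> Theta B theta -> Theta B theta' ->
  (forall c, `|coef theta c - coef theta' c| <= eta) -> cube x ->
  `|network phi theta x - network phi theta' x| <=
    L%:R * eta * (D.+1%:R * B) ^+ L.
Proof.
move=> L2 dD B1 eta0 tB tB' tt xc; rewrite !networkE.
set G := D.+1%:R * B.
have D1 : 1 <= D.+1%:R :> R by rewrite ler1n.
have G1 : 1 <= G by rewrite /G -[leLHS]mulr1 ler_pM.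
have DG : D.+1%:R <= G by rewrite /G ler_peMr.
have Gk k : 1 <= G ^+ k by rewrite exprn_ege1.
pose P k (h h' : 'cV[R]_D) := forall i, `|h i ord0| <= G ^+ k /\
  `|h i ord0 - h' i ord0| <= k%:R * eta * G ^+ k.
have step m k (a a' : 'I_m * option 'I_D -> R) (h h' : 'cV[R]_D) :
    (forall p, `|a p| <= B) -> (forall p, `|a' p| <= B) ->
    (forall p, `|a p - a' p| <= eta) -> P k h h' ->
    forall i, `|layer phi a h i ord0| <= G ^+ k.+1 /\
      `|layer phi a h i ord0 - layer phi a' h' i ord0| <= k.+1%:R * eta * G ^+ k.+1.
  move=> aB aB' aa hh i; split.
    by rewrite exprS; apply: layer_bound => // j; case: (hh j).
  have del0 : 0 <= k%:R * eta * G ^+ k by rewrite !mulr_ge0// (le_trans _ (Gk k)).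
  have := layer_diff (Gk k) aB' aa (fun j => (hh j).1) (fun j => (hh j).2) del0 i.
  move=> /le_trans; apply.
  rewrite -/G exprS -[k.+1%:R]natr1.
  have : D.+1%:R * eta * G ^+ k <= G * eta * G ^+ k.
    by rewrite ler_wpM2r ?(le_trans ler01)// ler_wpM2r.
  lra.
have first_step : P 1%N (layer phi (fun p => coef theta (inl (inl p))) (\col_i tnth x i))
    (layer phi (fun p => coef theta' (inl (inl p))) (\col_i tnth x i)).
  have x1 k : `|(\col_i tnth x i) k (ord0 : 'I_1)| <= 1.
    by rewrite mxE; have /andP[? ?] := xc k; rewrite ger0_norm.
  have d1 : d.+1%:R <= D.+1%:R :> R by rewrite ler_nat.
  move=> i; split.
    rewrite expr1; apply: (le_trans (layer_bound (lexx 1) (fun p => tB _) x1 i)).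
    by rewrite mulr1 ler_wpM2r// (le_trans ler01).
  have := @layer_diff _ _ (fun p => coef theta (inl (inl p)))
    (fun p => coef theta' (inl (inl p))) _ _ _ _ _ _ (lexx 1) (fun p => tB' _) (fun p => tt _) x1
    (fun k => eqW (etrans (congr1 Num.norm (subrr _)) (normr0 R))) (lexx 0) i.
  move=> /le_trans; apply; rewrite mulr0 addr0 mulr1 mul1r expr1 mulrC.
  by rewrite ler_wpM2l// (le_trans d1).
have fold s : forall k h h', P k h h' -> P (k + size s)%N
    (foldl (fun h l => layer phi (fun p => coef theta (inl (inr (l, p)))) h) h s)
    (foldl (fun h l => layer phi (fun p => coef theta' (inl (inr (l, p)))) h) h' s).
  elim: s => [|l s IHs] k h h' hh /=; first by rewrite addn0.
  rewrite addnS -addSn; apply: IHs; exact: step.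
have := fold (enum 'I_L.-2) _ _ _ first_step; rewrite size_enum_ord => hh.
have [_] := step 1%N _ (fun p => coef theta (inr p)) (fun p => coef theta' (inr p)) _ _
  (fun p => tB _) (fun p => tB' _) (fun p => tt _) hh ord0.
have LE : (1 + L.-2).+1 = L by rewrite add1n; case: (L) L2 => [|[|]].
by rewrite LE.
Qed.

End network.

(** * Prior mass near a parameter *)

Section prior_mass.
Context {R : realType} (d L D : nat).
Notation param := (#|coef_index d L D|.-tuple R).

Lemma ThetaE (B : R) : (Theta B : set (parameter d L D)) =
  [set x | forall i, `[- B, B]%classic (tnth x i)].
Proof.
apply/seteqP; split => x /= h i.
  by have := h (enum_val i); rewrite /coef enum_valK in_itv/= ler_norml.
by have := h (enum_rank i); rewrite in_itv/= -ler_norml.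
Qed.

Lemma measurable_Theta (B : R) : measurable (Theta B : set param).
Proof.
rewrite [X in measurable X](ThetaE B).
by apply: (@measurable_box _ _ _ (fun=> _)) => i; exact: measurable_itv.
Qed.

(** The parameter [theta0] may be on the boundary of the box [Theta B], so the cube
    is not centred: each of its sides runs from the coordinate of [theta0]
    towards 0, or past it by at most [eta <= B]. *)
Lemma prior_ball (B eta : R) (theta0 : parameter d L D) :
  1 <= B -> 0 < eta <= 1 -> Theta B theta0 ->
  exists U : set param, [/\ measurable U, U `<=` Theta B,
    forall theta, U theta -> forall c, `|coef theta c - coef theta0 c| <= eta &
    (((eta * normal_pdf 0 1 B) ^+ #|coef_index d L D|)%:E <=
      prior d L D U)%E].
Proof.
move=> B1 /andP[eta0 eta1]; rewrite (ThetaE B) => t0.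
pose lo (i : 'I_#|coef_index d L D|) : R :=
  if tnth theta0 i <= 0 then tnth theta0 i else tnth theta0 i - eta.
have lo_in i : [/\ - B <= lo i, lo i + eta <= B,
    lo i <= tnth theta0 i & tnth theta0 i <= lo i + eta].
  have := t0 i; rewrite /= in_itv/= => /andP[? ?]; rewrite /lo.
  by have [h|h] := leP (tnth theta0 i) 0; split; lra.
pose A i : set R := `[lo i, lo i + eta]%classic.
have mA i : measurable (A i) by exact: measurable_itv.
exists [set x | forall i, A i (tnth x i)]; split.
- exact: measurable_box.
- move=> x h i; have := h i; rewrite /A /= !in_itv/= => /andP[? ?].
  by have [? ? ? ?] := lo_in i; apply/andP; split; lra.
- move=> x h c; have := h (enum_rank c); rewrite /A /= in_itv/= => /andP[? ?].
  have [? ? ? ?] := lo_in (enum_rank c).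
  by rewrite /coef ler_norml; apply/andP; split; lra.
have -> : prior d L D [set x | forall i, A i (tnth x i)] =
    (\prod_i std_normal (A i))%E by exact: (power_prob_box std_normal mA).
apply: (@le_trans _ _ (\prod_(i < #|coef_index d L D|) (eta * normal_pdf 0 1 B)%:E)%E).
  by rewrite prodEFin prodr_const card_ord.
suff [] : (0 <= \prod_(i < #|coef_index d L D|) (eta * normal_pdf 0 1 B)%:E <=
    \prod_i std_normal (A i))%E /\ True by move=> /andP[].
split=> //; elim/big_ind2 : _ => [|x1 x2 y1 y2 /andP[? ?] /andP[? ?]|i _].
- by rewrite lee01 lexx.
- by rewrite mule_ge0// lee_pmul.
apply/andP; split; first by rewrite lee_fin mulr_ge0 ?normal_pdf_ge0// ltW.
have [? ? ? ?] := lo_in i.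
rewrite {1}(_ : eta = lo i + eta - lo i); last by ring.
by apply: std_normal_itv_ge => //; lra.
Qed.

Lemma Theta_zero (B : R) : 0 <= B ->
  Theta B ([tuple 0 | _ < #|coef_index d L D|] : parameter d L D).
Proof. by move=> B0 c; rewrite /coef tnth_mktuple normr0. Qed.

Lemma prior_Theta_gt0 (B : R) : 1 <= B -> (0 < prior d L D (Theta B))%E.
Proof.
move=> B1; have h := introT andP (conj (@ltr01 R) (lexx (1 : R))).
have [U [mU US _ piU]] := prior_ball B1 h (Theta_zero (le_trans ler01 B1)).
apply: (@lt_le_trans _ _ (prior d L D U)).
  by apply: lt_le_trans piU; rewrite lte_fin exprn_gt0// mulr_gt0// std_normal_pdf_gt0.
by apply: le_measure; rewrite ?inE//; exact: measurable_Theta.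
Qed.

Lemma card_coef_index_le : (0 < d)%N -> (d <= D)%N -> (2 <= L)%N ->
  (#|coef_index d L D| <= L * (D * D.+1))%N.
Proof.
move=> d0 dD L2; rewrite !card_sum !card_prod !card_option !card_ord mul1n.
have h1 : (D * d.+1 <= D * D.+1)%N by rewrite leq_mul2l ltnS dD orbT.
have h2 : (D.+1 <= D * D.+1)%N by rewrite leq_pmull// (leq_trans d0).
apply: (leq_trans (leq_add (leq_add h1 (leqnn _)) h2)).
by rewrite -{1}[(D * D.+1)%N]mul1n -mulnDl -{2}[(D * D.+1)%N]mul1n -mulnDl
  leq_mul2r add1n addn1; apply/orP; right; case: (L) L2 => [|[|]].
Qed.

End prior_mass.

(** * Rates *)

Section rates.
Context {R : realType} (d : nat) (beta : R).
Hypotheses (d0 : (0 < d)%N) (beta0 : 0 < beta).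

Let s : R := 2 * beta + d%:R.

Let dR : 0 < d%:R :> R.
Proof. by rewrite ltr0n. Qed.

Let s0 : 0 < s.
Proof. by rewrite /s; have := dR; have := beta0; lra. Qed.

Lemma ln2_gt0 : 0 < ln 2 :> R.
Proof. by apply: ln_gt0; rewrite ltr1n. Qed.

Lemma ln2_le n : (2 <= n)%N -> ln 2 <= ln n%:R :> R.
Proof. by move=> n2; rewrite ler_ln ?posrE ?ltr0n ?ler_nat// (leq_trans _ n2). Qed.

(** The exponent of [n] in [psi] is at least [- 1]. *)
Lemma inv_le_psi n : (2 <= n)%N -> n%:R^-1 <= (ln 2 ^+ 3)^-1 * psi d beta n.
Proof.
move=> n2; have l2 := ln2_gt0; have l2n := ln2_le n2.
rewrite mulrC ler_pdivlMr ?exprn_gt0// /psi; apply: ler_pM.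
- by rewrite invr_ge0.
- by rewrite exprn_ge0// ltW.
- rewrite -[n%:R^-1]powR_inv1//; apply: ler_powR; first by rewrite ler1n (leq_trans _ n2).
  rewrite -/s mulNr lerN2 ler_pdivrMr// mul1r /s.
  by have := dR; lra.
- by apply: lerXn2r => //; rewrite nnegrE ltW// (lt_le_trans l2).
Qed.

Let al : R := d%:R / (2 * s).

Let al1 : al <= 1.
Proof. by rewrite /al ler_pdivrMr ?mul1r ?mulr_gt0// /s; have := dR; have := beta0; lra. Qed.

(** Up to constants [p] is at most [L D^2 <= ln n * n^(d / (2 beta + d))], the
    logarithm is at most [(ln n)^2] because [L ln ((D + 1) B)] dominates it, and
    [d / (2 beta + d) - 1] is the exponent of [psi]. *)
Lemma complexity_le_psi (B phi0 cL cD : R) :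
  1 <= B -> 0 < phi0 -> 0 < cL -> 0 < cD ->
  exists2 K : R, 0 <= K & forall n L D p : nat,
    (2 <= n)%N -> (1 <= L)%N -> (1 <= D)%N ->
    L%:R <= cL * ln n%:R -> D%:R <= cD * n%:R `^ al ->
    (p <= L * (D * D.+1))%N ->
    p%:R / n%:R * - ln ((n%:R * L%:R * (D.+1%:R * B) ^+ L)^-1 * phi0)
      <= K * psi d beta n.
Proof.
move=> B1 p0 cL0 cD0; have l2 := ln2_gt0.
have lB : 0 <= ln B by exact: ln_ge0.
pose k1 := (`|ln (2 * cD)| + ln B) / ln 2 + 1.
pose k2 := (1 + cL) / ln 2 + cL * k1 + `|ln phi0| / (ln 2 ^+ 2).
have k10 : 0 <= k1 by rewrite /k1 addr_ge0// divr_ge0 ?addr_ge0// ltW.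
have k20 : 0 <= k2.
  by rewrite /k2 !addr_ge0 ?divr_ge0 ?mulr_ge0 ?exprn_ge0// ?ltW// addr_gt0.
exists (2 * cL * cD ^+ 2 * k2).
  by rewrite mulr_ge0// mulr_ge0 ?sqr_ge0// mulr_ge0// ltW.
move=> n L D p n2 L1 D1 Lle Dle ple.
have n0 : 0 < n%:R :> R by rewrite ltr0n (leq_trans _ n2).
have L0 : 0 < L%:R :> R by rewrite ltr0n.
have D1R : 1 <= D%:R :> R by rewrite ler1n.
have B0 : 0 < B by rewrite (lt_le_trans ltr01).
have DS : D.+1%:R <= 2 * D%:R :> R by rewrite -natr1; lra.
have DS0 : 0 < D.+1%:R :> R by rewrite ltr0n.
pose l : R := ln n%:R; rewrite -/l in Lle; have ll : ln 2 <= l by exact: ln2_le.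
have l0 : 0 < l by exact: lt_le_trans ll.
have lll : l <= l ^+ 2 / ln 2 by rewrite ler_pdivlMr// expr2 ler_wpM2l// ltW.
have l1 : 1 <= l / ln 2 by rewrite ler_pdivlMr// mul1r.
have G0 : 0 < D.+1%:R * B :> R by rewrite mulr_gt0.
have lnG : ln (D.+1%:R * B) <= k1 * l.
  rewrite lnM ?posrE//.
  have h1 : ln D.+1%:R <= ln (2 * cD) + al * l.
    have pw : 0 < n%:R `^ al by rewrite powR_gt0.
    rewrite -ln_powR -lnM ?posrE ?mulr_gt0// ler_ln ?posrE ?mulr_gt0//; lra.
  have h2 : al * l <= l by rewrite -[leRHS]mul1r ler_wpM2r// ltW.
  have h3 := ler_norm (ln (2 * cD)).
  have h4 : 0 <= `|ln (2 * cD)| + ln B by rewrite addr_ge0.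
  have -> : k1 * l = (`|ln (2 * cD)| + ln B) * (l / ln 2) + l by rewrite /k1; ring.
  have := ler_wpM2l h4 l1; rewrite mulr1; lra.
have lnL : ln L%:R <= cL * l by apply: le_trans Lle; exact/ltW/ln_sublinear.
have LlnG : L%:R * ln (D.+1%:R * B) <= cL * k1 * l ^+ 2.
  apply: (@le_trans _ _ (L%:R * (k1 * l))); first by rewrite ler_wpM2l// ltW.
  have -> : cL * k1 * l ^+ 2 = (cL * l) * (k1 * l) by ring.
  by rewrite ler_wpM2r// mulr_ge0// ltW.
have lnphi : - ln phi0 <= `|ln phi0| / ln 2 ^+ 2 * l ^+ 2.
  apply: (@le_trans _ _ (`|ln phi0|)); first by rewrite -normrN ler_norm.
  have -> : `|ln phi0| / ln 2 ^+ 2 * l ^+ 2 = `|ln phi0| * (l / ln 2) ^+ 2.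
    by rewrite expr_div_n; ring.
  by rewrite ler_peMr// exprn_ege1.
have tot : - ln ((n%:R * L%:R * (D.+1%:R * B) ^+ L)^-1 * phi0) <= k2 * l ^+ 2.
  rewrite lnM ?posrE ?invr_gt0 ?mulr_gt0 ?exprn_gt0//.
  rewrite lnV ?posrE ?mulr_gt0 ?exprn_gt0// lnM ?posrE ?mulr_gt0 ?exprn_gt0//.
  rewrite [ln (n%:R * _)]lnM ?posrE// lnXn// -[ln (D.+1%:R * B) *+ L]mulr_natl -/l /k2.
  have h : (1 + cL) * l <= (1 + cL) / ln 2 * l ^+ 2.
    have -> : (1 + cL) / ln 2 * l ^+ 2 = (1 + cL) * (l ^+ 2 / ln 2) by ring.
    by rewrite ler_wpM2l// addr_ge0// ltW.
  lra.
have pR : p%:R <= 2 * cL * cD ^+ 2 * (n%:R `^ al) ^+ 2 * l.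
  apply: (@le_trans _ _ (L * (D * D.+1))%:R); first by rewrite ler_nat.
  rewrite !natrM.
  have h1 : D%:R * D.+1%:R <= 2 * (cD * n%:R `^ al) ^+ 2.
    have := powR_ge0 n%:R al; nra.
  apply: (le_trans (ler_pM (ltW L0) _ Lle h1)); first by rewrite mulr_ge0.
  by rewrite exprMn -/l; lra.
have psiE : psi d beta n = (n%:R `^ al) ^+ 2 / n%:R * l ^+ 3.
  rewrite /psi -/l -/s; congr (_ * _).
  have nn : n%:R != 0 :> R by rewrite gt_eqF.
  have -> : n%:R^-1 = n%:R `^ (-1) :> R by rewrite powR_inv1// ltW.
  rewrite expr2 -powRD ?nn ?implybT// -powRD ?nn ?implybT//.
  by congr (_ `^ _); rewrite /al /s; field; rewrite gt_eqF.
rewrite psiE.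
apply: (@le_trans _ _ (p%:R / n%:R * (k2 * l ^+ 2))).
  by rewrite ler_wpM2l// divr_ge0.
have q0 : 0 <= n%:R^-1 * (k2 * l ^+ 2).
  by rewrite mulr_ge0 ?invr_ge0// mulr_ge0 ?sqr_ge0.
have := ler_wpM2r q0 pR.
have -> : p%:R / n%:R * (k2 * l ^+ 2) = p%:R * (n%:R^-1 * (k2 * l ^+ 2)) by ring.
by move=> /le_trans; apply; apply: eqW; ring.
Qed.

End rates.

(** * Oracle inequality for the posterior *)

Section iid_sample.
Context {R : realType} d d' (Omega : measurableType d) (S : measurableType d').
Variables (P : probability Omega R) (Z : {RV P >-> S}) (n : nat).
Variable Zs : 'I_n -> {RV P >-> S}.
Hypothesis iid : iid_copies Z Zs.

Lemma iid_prod_le (F : S -> R) (c : R) :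
  measurable_fun setT F -> (forall x, 0 <= F x) ->
  (\int[P]_w (F (Z w))%:E <= c%:E)%E ->
  (\int[P]_w (\prod_i F (Zs i w))%:E <= (c ^+ n)%:E)%E.
Proof.
move=> mF F0 Fc; have [indep law] := iid.
have mFe : measurable_fun setT (EFin \o F) by exact/measurable_EFinP.
have FE (X : {RV P >-> S}) : (\int[P]_w (F (X w))%:E =
    \int[distribution P X]_x (F x)%:E)%E.
  by rewrite ge0_integral_distribution// => x; rewrite lee_fin.
have := @mutually_independent_prod_le _ _ _ _ _ P n Zs (fun=> F) (fun=> c).
rewrite prodr_const card_ord; apply => // i.
rewrite FE (eq_measure_integral (distribution P Z)); last first.
  by move=> A mA _; exact: law.
by rewrite -FE.
Qed.

End iid_sample.

(** These inequalities dictate the form of [Cstar]; the third uses that the maximum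
    is at least [2 C], the last that it is at least [varsigma]. *)
Lemma Cstar_bounds {R : realType} (C sigma varsigma : R) :
  0 < C -> 0 < sigma -> 0 < varsigma ->
  let t := (Cstar C sigma varsigma)^-1 in
  [/\ 0 < t, t * sigma ^+ 2 <= 16^-1, t * C ^+ 2 <= 48^-1 &
      t * C * varsigma <= 16^-1].
Proof.
move=> C0 s0 v0 t.
have m1 : varsigma <= maxr varsigma (2 * C) by rewrite le_max lexx.
have m2 : 2 * C <= maxr varsigma (2 * C) by rewrite le_max lexx orbT.
have C2 : 0 < C ^+ 2 by rewrite exprn_gt0.
have s2 : 0 < sigma ^+ 2 by rewrite exprn_gt0.
have h1 := ler_wpM2l (ltW C0) m1; have h2 := ler_wpM2l (ltW C0) m2.
have K0 : 0 < Cstar C sigma varsigma.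
  by rewrite /Cstar; have := mulr_gt0 C0 v0; lra.
have tle a b : a <= b * Cstar C sigma varsigma -> t * a <= b.
  by move=> h; rewrite /t mulrC ler_pdivrMr.
split; first by rewrite invr_gt0.
- by apply: tle; rewrite /Cstar; lra.
- by apply: tle; rewrite /Cstar; lra.
- by rewrite -mulrA; apply: tle; rewrite /Cstar; lra.
Qed.

Section oracle.
Context {R : realType} (d n L D : nat) (phi : R -> R) (B C sigma varsigma : R).
Context d0 (Omega : measurableType d0) (P : probability Omega R).
Variables (f0 : d.-tuple R -> R) (Z : {RV P >-> (R * d.-tuple R)%type}).
Variable Zs : 'I_n -> {RV P >-> (R * d.-tuple R)%type}.
Hypotheses (n0 : (0 < n)%N) (L2 : (2 <= L)%N) (dD : (d <= D)%N).
Hypotheses (B1 : 1 <= B) (C0 : 0 < C) (sigma0 : 0 < sigma) (varsigma0 : 0 < varsigma).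
Hypotheses (lip : 1.-lipschitz phi) (phi_le : forall x, `|phi x| <= `|x|).
Hypothesis f0C : (sup_norm f0 <= C%:E)%E.
Hypothesis networkC : forall theta : parameter d L D, Theta B theta ->
  (sup_norm (network phi theta) <= C%:E)%E.
Hypotheses (model : regression_model f0 sigma varsigma Z) (iid : iid_copies Z Zs).

Notation param := (#|coef_index d L D|.-tuple R).
Let S : set param := Theta B.
Let net (theta : param) : d.-tuple R -> R := @network R d L D phi theta.
Let t := (Cstar C sigma varsigma)^-1.
Let lambda := n%:R / Cstar C sigma varsigma.
Let r w (theta : param) := empirical_risk (fun i => Zs i w) (net theta).
Let c w := lambda * empirical_risk (fun i => Zs i w) f0.
Let sq (theta : param) := sq_dist Z f0 (net theta).

Let tP := Cstar_bounds C0 sigma0 varsigma0.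

Let t0 : 0 < t. Proof. by case: tP. Qed.

Let nR : 0 < n%:R :> R. Proof. by rewrite ltr0n. Qed.

Let lambdaE : lambda = n%:R * t. Proof. by []. Qed.

Let lambda0 : 0 < lambda. Proof. by rewrite lambdaE mulr_gt0. Qed.

Let mf0 : measurable_fun setT f0. Proof. by case: model. Qed.

Let mnet theta : measurable_fun setT (net theta).
Proof. exact: (measurable_network lip (measurable_cst theta) (@measurable_id _ _ setT)). Qed.

Let mZs i : measurable_fun setT (Zs i). Proof. exact: measurable_funP. Qed.

Let mr : measurable_fun setT (fun p : Omega * param => r p.1 p.2).
Proof.
apply: measurable_funM => //; apply: measurable_sum => i.
have mZi : measurable_fun setT (fun p : Omega * param => Zs i p.1).
  exact: measurableT_comp.
apply: measurable_funX; apply: measurable_funB.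
  exact: (measurableT_comp measurable_fst mZi).
apply: (measurable_network lip) => //.
exact: (measurableT_comp measurable_snd mZi).
Qed.

Let r0 w theta : 0 <= r w theta.
Proof. by rewrite mulr_ge0 ?invr_ge0// sumr_ge0// => i _; rewrite sqr_ge0. Qed.

Let mc : measurable_fun setT c.
Proof.
apply: measurable_funM => //; apply: measurable_funM => //.
apply: measurable_sum => i; apply: measurable_funX; apply: measurable_funB.
  exact: (measurableT_comp measurable_fst (mZs i)).
exact: (measurableT_comp mf0 (measurableT_comp measurable_snd (mZs i))).
Qed.

Let msq : measurable_fun setT sq.
Proof.
apply: (measurableT_comp (fine_measurable measurableT)).
have mX : measurable_fun setT (fun p : param * Omega => (Z p.2).2).
  have mZ : measurable_fun setT Z by exact: measurable_funP.
  exact: (measurableT_comp measurable_snd (measurableT_comp mZ measurable_snd)).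
apply: (@measurable_parametric_integral _ _ _ _ _ P
  (fun theta w => (f0 (Z w).2 - net theta (Z w).2) ^+ 2)) => //; last first.
  by move=> w x; rewrite sqr_ge0.
apply: measurable_funX; apply: measurable_funB; first exact: measurableT_comp.
exact: (measurable_network lip).
Qed.

Let sq0 theta : 0 <= sq theta. Proof. exact: sq_dist_ge0. Qed.

Let lossE w theta : lambda * r w theta - c w =
  \sum_i t * excess_loss f0 (net theta) (Zs i w).
Proof.
rewrite /c -mulrBr /r /empirical_risk -mulrBr -sumrB lambdaE -mulr_sumr.
by rewrite mulrCA !mulrA mulVf ?gt_eqF// mul1r.
Qed.

Let mloss theta : measurable_fun setT (fun z => excess_loss f0 (net theta) z).
Proof.
by apply: measurable_funB; apply: measurable_funX; apply: measurable_funB => //;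
  exact: measurableT_comp.
Qed.

Let mprod (F : R * d.-tuple R -> R) : measurable_fun setT F ->
  measurable_fun setT (fun w => (\prod_i F (Zs i w))%:E).
Proof.
move=> mF; apply/measurable_EFinP; apply: measurable_prod => i _.
exact: measurableT_comp.
Qed.

Let moment_S theta : S theta ->
  (\int[P]_w (expR (3 / 4 * lambda * sq theta - (lambda * r w theta - c w)))%:E <= 1)%E.
Proof.
move=> St; have [_ h1 h2 h3] := tP.
pose F z := expR (- (t * excess_loss f0 (net theta) z)).
have mF : measurable_fun setT F.
  apply: measurableT_comp => //; apply: measurableT_comp => //.
  exact: measurable_funM.
have := iid_prod_le iid mF (fun z => expR_ge0 _)
  (integral_expRN_excess_loss_le model C0 f0C (mnet theta) (networkC St)
    varsigma0 t0 h1 h2 h3).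
rewrite -expRM_natl => H.
under eq_integral => w _.
  rewrite lossE expRD -sumrN expR_sum EFinM; over.
rewrite ge0_integralZl ?lee_fin ?expR_ge0//; last 2 first.
- exact: (mprod mF).
- by move=> w _; rewrite lee_fin prodr_ge0// => i _; rewrite expR_ge0.
apply: (le_trans (lee_wpmul2l _ H)); first by rewrite lee_fin expR_ge0.
rewrite -EFinM -expRD lee_fin -[leRHS]expR0 ler_expR lambdaE /sq; lra.
Qed.

Let moment_B theta : S theta ->
  (\int[P]_w (expR (lambda * r w theta - c w))%:E <=
   (expR (4 / 3 * lambda * sq theta))%:E)%E.
Proof.
move=> St; have [_ h1 h2 h3] := tP.
pose F z := expR (t * excess_loss f0 (net theta) z).
have mF : measurable_fun setT F.
  by apply: measurableT_comp => //; exact: measurable_funM.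
have := iid_prod_le iid mF (fun z => expR_ge0 _)
  (integral_expR_excess_loss_le model C0 f0C (mnet theta) (networkC St)
    varsigma0 t0 h1 h2 h3).
rewrite -expRM_natl => H.
under eq_integral => w _ do rewrite lossE expR_sum.
by apply: (le_trans H); rewrite lee_fin ler_expR lambdaE /sq; lra.
Qed.

Lemma risk_networkE theta : Theta B theta ->
  (risk P Z (net theta) = (fine (risk P Z f0) + sq theta)%:E)%E.
Proof.
move=> St; rewrite EFinD fineK; last exact: (risk_bayesE model).
exact: (risk_excess model C0 f0C (mnet theta) (networkC St)).
Qed.

Let pi := @prior R d L D.
Let post w := (\int[gibbs pi S lambda (r w)]_(theta in S) (sq theta)%:E)%E.

Let mS : measurable S. Proof. exact: measurable_Theta. Qed.

Let piS : (0 < pi S)%E. Proof. exact: prior_Theta_gt0. Qed.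

Let mrw w : measurable_fun setT (r w).
Proof. exact: (measurableT_comp mr (pair1_measurable w)). Qed.

Lemma posterior_riskE w :
  (\int[gibbs pi S lambda (r w)]_(theta in S) risk P Z (net theta) =
   risk P Z f0 + post w)%E.
Proof.
rewrite (@eq_integral_set_function _ _ _ _ _ _
  (fun theta => (fine (risk P Z f0) + 1 * sq theta)%:E)); last first.
  by move=> theta St; rewrite risk_networkE// mul1r.
rewrite (integral_gibbs_affine mS (mrw w) (ltW lambda0) (r0 w) piS)//.
  by rewrite mul1e fineK// (risk_bayesE model).
rewrite fine_ge0// /risk expectation_ge0// => x; exact: sqr_ge0.
Qed.

Lemma posterior_excess_measurable : measurable_fun setT post.
Proof.
exact: (measurable_gibbs_integral pi lambda mS mr msq sq0).
Qed.

Lemma posterior_excess_ge0 w : (0 <= post w)%E.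
Proof.
rewrite /post ge0_integral_gibbs//; last exact/measurable_EFinP.
apply: mule_ge0.
  by apply: integral_ge0 => x _; rewrite -EFinM lee_fin mulr_ge0// expR_ge0.
by rewrite lee_fin invr_ge0 fine_ge0// integral_ge0// => x _; rewrite lee_fin expR_ge0.
Qed.

Section fixed_center.
Variables (theta0 : param) (eta : R).
Hypotheses (Stheta0 : Theta B theta0) (eta01 : 0 < eta <= 1).
Hypothesis eta_small : L%:R * eta * (D.+1%:R * B) ^+ L <= n%:R^-1.

Let p := #|coef_index d L D|.
Let phi0 : R := normal_pdf 0 1 B.
Let k := 3 / 4 * lambda.
Let rem := 16 / 3 * n%:R^-1 ^+ 2 +
  4 / 3 * (Cstar C sigma varsigma * (p%:R / n%:R * - ln (eta * phi0))).

Let ball : exists U : set param, [/\ measurable U, U `<=` S, (0 < pi U)%E,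
  - ln (fine (pi U)) <= p%:R * - ln (eta * phi0) &
  forall theta, U theta -> sq theta <= 3 / 2 * sq theta0 + 3 * n%:R^-1 ^+ 2].
Proof.
have [U [mU US Ueta piU]] := prior_ball B1 eta01 Stheta0.
have ep0 : 0 < eta * phi0 by rewrite mulr_gt0 ?std_normal_pdf_gt0//; case/andP: eta01.
have piU0 : (0 < pi U)%E by rewrite (lt_le_trans _ piU)// lte_fin exprn_gt0.
exists U; split => //.
  rewrite mulrN lerN2 mulr_natl -lnXn// ler_ln ?posrE ?exprn_gt0//.
    by rewrite -lee_fin fineK// fin_num_measure.
  by rewrite fine_gt0// piU0 (le_lt_trans (probability_le1 _ _)) ?ltry.
move=> theta Utheta.
apply: (sq_dist_perturb model C0 f0C (mnet theta) (mnet theta0)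
  (networkC (US _ Utheta)) (networkC Stheta0)) => x xc.
apply: le_trans eta_small.
apply: (network_lipschitz lip phi_le) => //; first by case/andP: eta01 => /ltW.
- exact: US.
- exact: Ueta.
Qed.

Let k0 : 0 < k. Proof. by rewrite mulr_gt0. Qed.

Let postE w : (\int[gibbs pi S lambda (r w)]_(theta in S) (k * sq theta)%:E =
  k%:E * post w)%E.
Proof.
have := @integral_gibbs_affine _ _ _ pi S lambda (r w) mS (mrw w)
  (ltW lambda0) (r0 w) sq 0 k piS msq sq0 (lexx _) (ltW k0).
by rewrite add0e => <-; apply: eq_integral_set_function => x _; rewrite add0r.
Qed.

(* An upper bound for the exponential moments at the parameters of the cube. *)
Let w0 := expR (4 / 3 * lambda * (3 / 2 * sq theta0 + 3 * n%:R^-1 ^+ 2)).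

Let w01 : 1 <= w0.
Proof.
rewrite -[leLHS]expR0 ler_expR mulr_ge0//; first by rewrite mulr_ge0// ltW.
by rewrite addr_ge0// mulr_ge0 ?sqr_ge0.
Qed.

(* The division by [k = 3/4 lambda] turns the factor [4/3 lambda * 3/2] of [sq theta0]
   into [8/3]. *)
Let kbound (q : R) : q <= p%:R * - ln (eta * phi0) ->
  k^-1 * (ln w0 + q) <= 8 / 3 * sq theta0 + rem.
Proof.
move=> qle; rewrite ler_pdivrMl// /w0 expRK /rem.
apply: (le_trans (lerD (lexx _) qle)); apply: eqW.
rewrite /k /lambda; field; rewrite !gt_eqF//.
by rewrite -invr_gt0.
Qed.

Let mpost := posterior_excess_measurable.
Let post0 := posterior_excess_ge0.

Lemma posterior_excess_expectation_le :
  (\int[P]_w post w <= (8 / 3 * sq theta0 + rem)%:E)%E.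
Proof.
have [U [mU US piU lnU Usq]] := ball.
have mk : measurable_fun setT (fun theta => k * sq theta) by exact: measurable_funM.
have ksq0 theta : 0 <= k * sq theta by rewrite mulr_ge0// ltW.
have momU theta : U theta ->
    (\int[P]_w (expR (lambda * r w theta - c w))%:E <= w0%:E)%E.
  move=> Ut; apply: (le_trans (moment_B (US _ Ut))).
  by rewrite lee_fin ler_expR ler_wpM2l ?Usq// mulr_ge0// ltW.
have := gibbs_integral_expectation_le mS mU US piU (ltW lambda0) mr r0 mc mk
  ksq0 w01 moment_S momU.
under eq_integral do rewrite postE.
rewrite ge0_integralZl ?lee_fin ?(ltW k0)// => h.
rewrite -(@lee_pmul2l _ k%:E) ?lte_fin//.
apply: (le_trans h); rewrite -EFinM lee_fin -ler_pdivrMl//.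
exact: kbound.
Qed.

Lemma posterior_excess_deviation_le (delta : R) : 0 < delta ->
  ((1 - delta)%:E <= P [set w | post w <=
    (8 / 3 * sq theta0 + rem + k^-1 * (2 * ln delta^-1))%:E])%E.
Proof.
move=> delta0; have [U [mU US piU lnU Usq]] := ball.
have mk : measurable_fun setT (fun theta => k * sq theta) by exact: measurable_funM.
have ksq0 theta : 0 <= k * sq theta by rewrite mulr_ge0// ltW.
have momU theta : U theta ->
    (\int[P]_w (expR (lambda * r w theta - c w))%:E <= w0%:E)%E.
  move=> Ut; apply: (le_trans (moment_B (US _ Ut))).
  by rewrite lee_fin ler_expR ler_wpM2l ?Usq// mulr_ge0// ltW.
have := gibbs_integral_deviation_le mS mU US piU (ltW lambda0) mr r0 mc mk
  ksq0 w01 moment_S momU delta0.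
move=> /le_trans; apply; apply: le_measure; rewrite ?inE.
- rewrite (_ : [set w | _] = setT `&` [set w | (k%:E * post w <=
    (ln w0 - ln (fine (pi U)) + 2 * ln delta^-1)%:E)%E]); last first.
    by rewrite setTI; apply/seteqP; split => w /=; rewrite postE.
  by apply: emeasurable_fun_infty_c => //; exact: emeasurable_funM.
- rewrite -[X in measurable X]setTI; exact: emeasurable_fun_infty_c.
move=> w /=; rewrite postE => h.
rewrite -(@lee_pmul2l _ k%:E) ?lte_fin//.
apply: (le_trans h); rewrite -EFinM lee_fin -ler_pdivrMl// mulrDr lerD2r.
exact: kbound.
Qed.

End fixed_center.
End oracle.

(** * The convergence rate *)

Lemma near_minimizer {R : realType} (T : Type) (S : set T) (f : T -> R) (x0 : T)
    (eps : R) :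
  S x0 -> (forall x, 0 <= f x) -> 0 < eps ->
  exists2 x, S x & forall y, S y -> f x <= f y + eps.
Proof.
move=> Sx0 f0 eps0; have fS : has_inf (f @` S).
  by split; [exists (f x0), x0|exists 0 => _ [y _ <-]].
have [_ [x Sx <-] fx] := inf_adherent eps0 fS; exists x => // y Sy.
rewrite (le_trans (ltW fx))// lerD2r; apply: ge_inf; first by case: fS.
by exists y.
Qed.

(** The excess risk at a near minimizer replaces the infimum at the cost [c eps]. *)
Lemma scaled_ereal_inf_ge {R : realType} (T : Type) (S : set T) (E : T -> \bar R)
    (f : T -> R) (x : T) (eps c : R) :
  0 <= c -> (forall y, S y -> E y = (f y)%:E) ->
  (forall y, S y -> f x <= f y + eps) ->
  ((c * f x)%:E <= ereal_inf [set c%:E * E y | y in S] + (c * eps)%:E)%E.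
Proof.
move=> c0 EE fx; rewrite -leeBlDr// -EFinB; apply: le_ereal_inf_tmp.
move=> _ [y Sy <-]; rewrite EE// -EFinM lee_fin.
have := ler_wpM2l c0 (fx y Sy); lra.
Qed.

Theorem theorem1 (R : realType) (d : nat) (beta B C sigma varsigma : R)
    (cL cL' cD cD' : R) :
  (0 < d)%N -> 0 < beta -> 1 <= B -> 1 <= C -> 0 < sigma -> 0 < varsigma ->
  0 < cL -> 0 < cL' -> 0 < cD -> 0 < cD' ->
  exists2 K : R, 0 < K &
  forall (n L D : nat) (phi : R -> R) (f0 : d.-tuple R -> R)
    (d0 : measure_display) (Omega : measurableType d0)
    (P : probability Omega R)
    (Z : {RV P >-> (R * d.-tuple R)%type})
    (Zs : 'I_n -> {RV P >-> (R * d.-tuple R)%type}),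
  (2 <= n)%N -> (3 <= L)%N -> (d <= D)%N ->
  cL * ln n%:R <= L%:R <= cL' * ln n%:R ->
  cD * n%:R `^ (d%:R / (2 * (2 * beta + d%:R))) <= D%:R
    <= cD' * n%:R `^ (d%:R / (2 * (2 * beta + d%:R))) ->
  1.-lipschitz phi -> (forall x, `|phi x| <= `|x|) ->
  (sup_norm f0 <= C%:E)%E ->
  (forall theta : parameter d L D, Theta B theta ->
     sup_norm (network phi theta) <= C%:E)%E ->
  regression_model f0 sigma varsigma Z ->
  iid_copies Z Zs ->
  let lambda := n%:R / Cstar C sigma varsigma in
  let R_ (theta : parameter d L D) := risk P Z (network phi theta) in
  let R0 := risk P Z f0 in
  let r_ w (theta : parameter d L D) :=
    empirical_risk (fun i => Zs i w) (network phi theta) in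
  let rho w := gibbs (prior d L D) (Theta B) lambda (r_ w) in
  let post_risk w := (\int[rho w]_(theta in Theta B) R_ theta)%E in
  let excess theta := (R_ theta - R0)%E in
  ((\int[P]_w post_risk w - R0 <=
     ereal_inf [set (8 / 3)%:E * excess theta | theta in Theta B]
     + (K * psi d beta n)%:E)%E) /\
  (forall delta : R, 0 < delta < 1 ->
   ((1 - delta)%:E <=
    P [set w | post_risk w - R0 <=
        ereal_inf [set 4%:E * excess theta | theta in Theta B]
        + (K * psi d beta n)%:E + (K * (ln (2 / delta) / n%:R))%:E])%E).
Proof.
move=> dgt0 beta0 B1 C1 sigma0 varsigma0 cL0 cL'0 cD0 cD'0.
have C0 : 0 < C := lt_le_trans ltr01 C1.
have phi00 := std_normal_pdf_gt0 B.
have [K1 K10 complexity] := complexity_le_psi dgt0 beta0 B1 phi00 cL'0 cD'0.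
set Cst := Cstar C sigma varsigma.
have Cst0 : 0 < Cst.
  by have [t0 _ _ _] := Cstar_bounds C0 sigma0 varsigma0; rewrite -invr_gt0.
pose c2 : R := (ln 2 ^+ 3)^-1.
have c20 : 0 < c2 by rewrite invr_gt0 exprn_gt0// ln2_gt0.
(* The first term absorbs [16/3 n^-2] and the error, at most [4 / n], of the near minimizer,
   the second the complexity of the networks, the third the deviation term. *)
pose K := 10 * c2 + 4 / 3 * (Cst * K1) + 8 / 3 * Cst.
have CK0 : 0 <= Cst * K1 by rewrite mulr_ge0// ltW.
exists K; first by rewrite /K; lra.
move=> n L D phi f0 d0 Omega P Z Zs n2 L3 dD /andP[_ Lle] /andP[_ Dle] lip phi_le.
move=> f0C networkC model iid lambda R_ R0 r_ rho post_risk excess.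
have n0 : (0 < n)%N by rewrite (leq_trans _ n2).
have D0 : (0 < D)%N by rewrite (leq_trans dgt0).
have L0 : (0 < L)%N by rewrite (leq_trans _ L3).
have L2 : (2 <= L)%N by rewrite (leq_trans _ L3).
have nR : 0 < n%:R :> R by rewrite ltr0n.
have n1R : 1 <= n%:R :> R by rewrite ler1n.
have L1R : 1 <= L%:R :> R by rewrite ler1n.
have G1 : 1 <= D.+1%:R * B by rewrite -[leLHS]mulr1 ler_pM// ler1n.
have GL1 : 1 <= (D.+1%:R * B) ^+ L by rewrite exprn_ege1.
pose eta := (n%:R * L%:R * (D.+1%:R * B) ^+ L)^-1.
have den1 : 1 <= n%:R * L%:R * (D.+1%:R * B) ^+ L.
  by rewrite -[leLHS]mulr1 ler_pM// -[leLHS]mulr1 ler_pM.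
have eta01 : 0 < eta <= 1.
  by rewrite invr_gt0 (lt_le_trans ltr01)//= invf_le1// (lt_le_trans ltr01).
have eta_small : L%:R * eta * (D.+1%:R * B) ^+ L <= n%:R^-1.
  apply: eqW; rewrite /eta; field.
  by rewrite !gt_eqF// (lt_le_trans ltr01).
pose sq (theta : parameter d L D) := sq_dist Z f0 (network phi theta).
have sq0 theta : 0 <= sq theta by exact: sq_dist_ge0.
have invn : n%:R^-1 <= c2 * psi d beta n by exact: inv_le_psi.
have invn0 : 0 < n%:R^-1 :> R by rewrite invr_gt0.
have [theta0 Stheta0 min0] :=
  near_minimizer (Theta_zero (le_trans ler01 B1)) sq0 invn0.
have R0fin : R0 \is a fin_num by exact: (risk_bayesE model).
have R00 : 0 <= fine R0.
  by rewrite fine_ge0// /R0 /risk expectation_ge0// => w; exact: sqr_ge0.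
have excessE theta : Theta B theta -> excess theta = (sq theta)%:E.
  move=> St; rewrite /excess /R_ (risk_networkE C0 lip f0C networkC model St).
  by rewrite EFinD fineK// addeAC subee// add0e.
pose post w := (\int[rho w]_(theta in Theta B) (sq theta)%:E)%E.
have post_riskE w : post_risk w = (R0 + post w)%E.
  exact: (posterior_riskE Zs n0 B1 C0 sigma0 varsigma0 lip f0C networkC model w).
have infE c : 0 <= c -> ((c * sq theta0)%:E <=
    ereal_inf [set c%:E * excess theta | theta in Theta B] + (c / n%:R)%:E)%E.
  by move=> c0; exact: scaled_ereal_inf_ge.
pose p := #|coef_index d L D|.
pose rem := 16 / 3 * n%:R^-1 ^+ 2 +
  4 / 3 * (Cst * (p%:R / n%:R * - ln (eta * normal_pdf 0 1 B))).
have psi0 : 0 <= psi d beta n.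
  by rewrite -(pmulr_rge0 _ c20) (le_trans _ invn)// ltW.
have remle : rem + 4 / n%:R <= K * psi d beta n.
  have h1 : n%:R^-1 ^+ 2 <= n%:R^-1 :> R.
    by rewrite expr2 ler_piMl ?(ltW invn0)// invf_le1.
  have h2 := complexity n L D p n2 L0 D0 Lle Dle (card_coef_index_le dgt0 dD L2).
  have h3 := ler_wpM2l (ltW Cst0) h2.
  have h4 : 0 <= 8 / 3 * Cst * psi d beta n by rewrite mulr_ge0// mulr_ge0// ltW.
  rewrite /rem /K -/eta in h3 *; rewrite !mulrDl; lra.
have mpost : measurable_fun setT post.
  exact: (posterior_excess_measurable L D B C Zs lip model).
have post0 w : (0 <= post w)%E.
  exact: (posterior_excess_ge0 L D B C Zs lip model).
have Epost : (\int[P]_w post w <= (8 / 3 * sq theta0 + rem)%:E)%E.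
  exact: (posterior_excess_expectation_le n0 L2 dD B1 C0 sigma0 varsigma0 lip
    phi_le f0C networkC model iid Stheta0 eta01 eta_small).
have sub_R0 x : (R0 + x - R0 = x)%E by rewrite addeAC subee// add0e.
split.
  have -> : (\int[P]_w post_risk w = R0 + \int[P]_w post w)%E.
    under eq_integral do rewrite post_riskE.
    rewrite ge0_integralD//; last by rewrite -(fineK R0fin) => w _; rewrite lee_fin.
    by rewrite integral_cst// [X in (_ * X + _)%E]probability_setT mule1.
  rewrite sub_R0; apply: (le_trans Epost).
  have c0 : 0 <= 8 / 3 :> R by [].
  rewrite EFinD; apply: (le_trans (leeD (infE _ c0) (lexx _))).
  rewrite -addeA leeD2l// -EFinD lee_fin (le_trans _ remle)// addrC lerD2l.
  by rewrite ler_wpM2r ?(ltW invn0)//; lra.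
move=> delta /andP[delta0 delta1].
have -> : [set w | (post_risk w - R0 <=
      ereal_inf [set 4%:E * excess theta | theta in Theta B]
      + (K * psi d beta n)%:E + (K * (ln (2 / delta) / n%:R))%:E)%E] =
    [set w | (post w <= ereal_inf [set 4%:E * excess theta | theta in Theta B]
      + (K * psi d beta n)%:E + (K * (ln (2 / delta) / n%:R))%:E)%E].
  by apply/seteqP; split => w /=; rewrite post_riskE sub_R0.
have := posterior_excess_deviation_le n0 L2 dD B1 C0 sigma0 varsigma0 lip
    phi_le f0C networkC model iid Stheta0 eta01 eta_small delta0.
move=> /le_trans; apply; apply: le_measure; rewrite ?inE.
- rewrite -[X in measurable X]setTI; exact: emeasurable_fun_infty_c.
- rewrite -[X in measurable X]setTI; exact: emeasurable_fun_infty_c.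
move=> w /= /le_trans; apply; rewrite 2!EFinD; apply: leeD; last first.
  have lnd : 0 <= ln delta^-1 by rewrite ln_ge0// -invr1 lef_pV2 ?posrE// ltW.
  have ln2d : ln delta^-1 <= ln (2 / delta).
    rewrite lnM ?posrE ?invr_gt0// lerDr; exact/ltW/ln2_gt0.
  rewrite lee_fin.
  have -> : (3 / 4 * (n%:R / Cst))^-1 * (2 * ln delta^-1) =
      8 / 3 * Cst * (ln delta^-1 / n%:R).
    by field; rewrite !gt_eqF.
  apply: ler_pM.
  - by rewrite mulr_ge0// ltW.
  - by rewrite divr_ge0.
  - by rewrite /K; lra.
  - by rewrite ler_wpM2r// ltW.
have c0 : 0 <= 4 :> R by [].
have le4 : ((8 / 3 * sq theta0)%:E <= (4 * sq theta0)%:E)%E.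
  by rewrite lee_fin ler_wpM2r//; lra.
apply: (le_trans (leeD (le_trans le4 (infE _ c0)) (lexx _))).
by rewrite -addeA leeD2l// -EFinD lee_fin addrC.
Qed.
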